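(* Let $g$ be a univalent analytic function on $\mathbb{D}$ with strictly positive real part, let $0<\gamma<1$, let $\phi(z)=|g(z)|^\gamma$, and let $1\le p<\infty$. (i) There exists a constant $C_p>0$ such that, for all $f\in A^p_\phi$, $$|f(z)|\le\frac{C_p}{(1-|z|)^{\frac2p}\,|g(z)|^{\gamma/p}}\|f\|_{A^p_\phi},\qquad z\in\mathbb{D}.$$ (ii) For each $n\ge0$, there exists a constant $C_p'>0$, depending only on $p$, such that, for all $f\in A^p_\phi$, $$\frac{|f^{(n)}(0)|}{n!}\le\frac{C_p'\,\|f\|_{A^p_\phi}}{r^n(1-r)^{\frac2p}}\int_0^{2\pi}\frac{1}{|g(re^{i\theta})|^{\frac\gamma p}}\,d\theta,\qquad 0<r<1.$$
   Context: $\mathbb{D}$ is the open unit disc in $\mathbb{C}$ and $dA=\frac1\pi dx\,dy$. $A^p_\phi$ is the space of analytic $f$ on $\mathbb{D}$ with $\|f\|^p_{A^p_\phi}=\int_{\mathbb{D}}|f|^p\phi\,dA<\infty$. *)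

(* Defs.v *)
From HB Require Import structures.
From mathcomp Require Import all_boot all_order all_algebra.
From mathcomp Require Import all_classical all_reals all_analysis.
From mathcomp Require Import complex.

Set Implicit Arguments.
Unset Strict Implicit.
Unset Printing Implicit Defensive.

Import Order.TTheory GRing.Theory Num.Theory.
Import numFieldNormedType.Exports.

Local Open Scope classical_set_scope.
Local Open Scope ring_scope.
Local Open Scope complex_scope.

(* The library's norm on [R[i]] takes its values in [R[i]]; [cabs] is the
   R-valued modulus. *)
Definition cabs (R : realType) (z : R[i]) : R := complex.Re `|z|.

Definition disc (R : realType) : set R[i] := [set z | cabs z < 1].

(* Complex differentiability: [R[i]^o] is a normed module over the field R[i],
   so the direction 1 gives the complex derivative. *)
Definition analytic_on_disc (R : realType) (f : R[i]^o -> R[i]^o) : Prop :=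
  forall z : R[i]^o, disc z -> derivable f z 1.

Definition univalent (R : realType) (f : R[i]^o -> R[i]^o) : Prop :=
  analytic_on_disc f /\ {in @disc R &, injective f}.

Lemma inv_pi_ge0 (R : realType) : 0 <= (pi : R)^-1.
Proof. by rewrite invr_ge0 pi_ge0. Qed.

(* dA = (1/pi) dx dy, as a measure on the plane R * R, whose point (x, y)
   stands for the complex number x +i* y. *)
Definition dA (R : realType) :=
  mscale (NngNum (inv_pi_ge0 R))
    (@lebesgue_measure R \x @lebesgue_measure R)%E.

Definition bergman_integral (R : realType) (phi : R[i] -> R) (p : R)
    (f : R[i]^o -> R[i]^o) : \bar R :=
  (\int[@dA R]_(w in [set w | disc (w.1 +i* w.2)])
     (cabs (f (w.1 +i* w.2)) `^ p * phi (w.1 +i* w.2))%:E)%E.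

Definition bergman (R : realType) (phi : R[i] -> R) (p : R)
    (f : R[i]^o -> R[i]^o) : Prop :=
  analytic_on_disc f /\ (bergman_integral phi p f < +oo)%E.

Definition bergman_norm (R : realType) (phi : R[i] -> R) (p : R)
    (f : R[i]^o -> R[i]^o) : R :=
  fine (bergman_integral phi p f) `^ p^-1.

(* Main.v *)
Require Import Defs.
From HB Require Import structures.
From mathcomp Require Import all_boot all_order all_algebra.
From mathcomp Require Import all_classical all_reals all_analysis.
From mathcomp Require Import complex.
From mathcomp Require Import measurable_realfun.
From mathcomp Require Import ring lra.

Import Order.TTheory GRing.Theory Num.Theory.
Import numFieldNormedType.Exports.

Local Open Scope classical_set_scope.
Local Open Scope ring_scope.
Local Open Scope complex_scope.

Set Implicit Arguments.
Unset Strict Implicit.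
Unset Printing Implicit Defensive.

(** A function [g] with positive real part is comparable with its value at the centre
of a disc whose radius is a small multiple of the distance to the boundary: with [y = g z], the Cayley transform
[(g - y) / (g + conj y)] is bounded by 1 and vanishes at [z], so Cauchy's formula
makes it at most 1/2 near [z], whence [|g z| <= 3 |g w|] there.
Thus [|g|^gamma] may be moved across the area mean of [|f|^p], which yields (i).
The area mean itself comes from Cauchy's formula on the squares of half-side [t]
around [z], integrated over [t] in [[rho / 2, rho]]: four reflected copies of one
rectangle appear, so that Tonelli and translation invariance suffice and no polar
coordinates are needed. The bound [x <= l + l (x / l)^p] replaces Jensen.
Part (ii) is the Cauchy estimate for Taylor coefficients with (i) on the circle.

Complex differentiability is pointwise, hence Cauchy's theorem is proved by
Goursat's bisection, for the pullback of [H(w) dw / w] to the rectangle of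
parameters [(t, y)] under [w = t c(y)], where [c] parametrizes a circle around a
point or a side of a square. *)

(** * The modulus and the topology of R[i] *)

(** Integrating [H(w) dw / w] along rays does not need a closed curve: it is enough that [H] agrees
    on the first and the last ray. This is why one side of a square can stand for the whole boundary
    once [f] is summed over the four quarter turns. The form has a pole at [t = 0], so the bisection
    runs on [t >= d], and letting [d] tend to 0 uses only the continuity of [H] at 0. Complex
    integrals are taken by components, which costs a factor 2 in estimates of moduli; the bound on
    the Cayley transform, the Cauchy estimate and the mean over squares therefore carry constants
    that are not sharp. None of these depends on [g] or [gamma], because [3 ^ gamma <= 3], so the
    constants of the theorem depend on [p] alone. The scale [l] in the bound that replaces Jensen
    stays free until the end, where its choice restores homogeneity in [f]. *)

Section Modulus.
Variable R : realType.
Implicit Types (z w : R[i]) (x : R).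

Lemma cabsE z : cabs z = Normc.normc z.
Proof. by []. Qed.

Lemma norm_cabs z : `|z| = (cabs z)%:C.
Proof. by []. Qed.

Lemma cabs_ge0 z : 0 <= cabs z.
Proof. by rewrite cabsE; case: z => a b; exact: sqrtr_ge0. Qed.

Lemma cabs0 : cabs (0 : R[i]) = 0.
Proof. exact: Normc.normc0. Qed.

Lemma cabs_eq0 z : (cabs z == 0) = (z == 0).
Proof. by apply/eqP/eqP => [/Normc.eq0_normc|->] //; exact: cabs0. Qed.

Lemma cabs_gt0 z : (0 < cabs z) = (z != 0).
Proof. by rewrite lt_def cabs_ge0 andbT cabs_eq0. Qed.

Lemma cabsM z w : cabs (z * w) = cabs z * cabs w.
Proof. exact: Normc.normcM. Qed.

Lemma cabsV z : cabs z^-1 = (cabs z)^-1.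
Proof. exact: Normc.normcV. Qed.

Lemma cabs1 : cabs (1 : R[i]) = 1.
Proof. exact: Normc.normc1. Qed.

Lemma cabsX z n : cabs (z ^+ n) = cabs z ^+ n.
Proof. by elim: n => [|n IH]; rewrite ?cabs1// !exprS cabsM IH. Qed.

Lemma cabsN z : cabs (- z) = cabs z.
Proof. by rewrite /cabs normrN. Qed.

Lemma cabsBC z w : cabs (z - w) = cabs (w - z).
Proof. by rewrite -cabsN opprB. Qed.

Lemma cabsD z w : cabs (z + w) <= cabs z + cabs w.
Proof. exact: le_normcD. Qed.

Lemma cabsB z w : cabs (z - w) <= cabs z + cabs w.
Proof. by rewrite -(cabsN w); exact: cabsD. Qed.

Lemma cabsB_ge z w : cabs z - cabs w <= cabs (z - w).
Proof. by rewrite lerBlDr -{1}(subrK w z); exact: cabsD. Qed.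

Lemma cabs_real x : cabs x%:C = `|x|.
Proof. by rewrite cabsE /= expr0n addr0 sqrtr_sqr. Qed.

Lemma cabs_i : cabs ('i : R[i]) = 1.
Proof. by rewrite cabsE /= expr0n expr1n add0r sqrtr1. Qed.

Lemma cabs_conj z : cabs (conjc z) = cabs z.
Proof. by rewrite !cabsE; case: z => a b /=; rewrite sqrrN. Qed.

Lemma cabs_sqr z : cabs z ^+ 2 = complex.Re z ^+ 2 + complex.Im z ^+ 2.
Proof.
by case: z => a b; rewrite cabsE /= sqr_sqrtr// addr_ge0// sqr_ge0.
Qed.

Lemma cabs_ge_Re z : `|complex.Re z| <= cabs z.
Proof.
by rewrite -(@ler_pXn2r _ 2)// ?nnegrE// ?cabs_ge0// real_normK ?num_real//
  cabs_sqr lerDl sqr_ge0.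
Qed.

Lemma cabs_ge_Im z : `|complex.Im z| <= cabs z.
Proof.
by rewrite -(@ler_pXn2r _ 2)// ?nnegrE// ?cabs_ge0// real_normK ?num_real//
  cabs_sqr lerDr sqr_ge0.
Qed.

Lemma cabs_le_ReIm z : cabs z <= `|complex.Re z| + `|complex.Im z|.
Proof.
have -> : z = (complex.Re z)%:C + 'i * (complex.Im z)%:C by rewrite -complexE.
by apply: (le_trans (cabsD _ _)); rewrite cabsM cabs_i mul1r !cabs_real -complexE.
Qed.

Lemma complexReD z w : complex.Re (z + w) = complex.Re z + complex.Re w.
Proof. by case: z w => [a b] [c d]. Qed.

Lemma complexImD z w : complex.Im (z + w) = complex.Im z + complex.Im w.
Proof. by case: z w => [a b] [c d]. Qed.

Lemma complexReM z w :
  complex.Re (z * w) = complex.Re z * complex.Re w - complex.Im z * complex.Im w.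
Proof. by case: z w => [a b] [c d]. Qed.

Lemma complexImM z w :
  complex.Im (z * w) = complex.Re z * complex.Im w + complex.Im z * complex.Re w.
Proof. by case: z w => [a b] [c d]. Qed.

Lemma complexReN z : complex.Re (- z) = - complex.Re z.
Proof. by case: z. Qed.

Lemma complexImN z : complex.Im (- z) = - complex.Im z.
Proof. by case: z. Qed.

(** The order of [R[i]] compares only numbers with equal imaginary parts, so every positive radius
    in a complex-valued filter statement is real. *)
Lemma gt0_complex (e : R[i]) : 0 < e -> exists2 r : R, 0 < r & e = r%:C.
Proof.
move=> e0; have er : e \is Num.real by rewrite gtr0_real.
by move/complex_realP : er e0 => [r ->]; rewrite ltcR => r0; exists r.
Qed.

End Modulus.

(** * Limits, continuity and complex derivatives in terms of the real modulus *)

Section Topology.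
Variable R : realType.
Local Notation C := (R[i]^o).

Lemma cvg_cabsP (T : Type) (F : set_system T) (f : T -> C) (l : C) :
  Filter F ->
  f x @[x --> F] --> l <->
  forall e : R, 0 < e -> \forall x \near F, cabs (f x - l) < e.
Proof.
move=> FF; split=> [/cvgrPdist_lt fl e e0|fl].
  have : 0 < e%:C by rewrite ltcR.
  move=> /fl; apply: filterS => x.
  by rewrite norm_cabs ltcR cabsBC.
apply/cvgrPdist_lt => e /gt0_complex[r r0 ->]; apply: filterS (fl _ r0) => x.
by rewrite norm_cabs ltcR cabsBC.
Qed.

Lemma nbhs_cabsP (z : C) (A : set C) :
  nbhs z A <-> exists2 e : R, 0 < e & forall w, cabs (w - z) < e -> A w.
Proof.
split.
  move=> /nbhs_ballP[e /gt0_complex[r r0 ->]] eA; exists r => // w wr.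
  by apply: eA; rewrite -ball_normE /= norm_cabs ltcR cabsBC.
move=> [e e0 eA]; apply/nbhs_ballP; exists e%:C; first by rewrite /= ltcR.
by move=> w; rewrite -ball_normE /= norm_cabs ltcR cabsBC; exact: eA.
Qed.

Lemma continuous_Re : continuous (fun z : C => complex.Re z : R^o).
Proof.
move=> z; apply/(@cvgrPdist_lt R R^o C (nbhs z)) => e e0; apply/nbhs_cabsP; exists e => // w.
apply: le_lt_trans; rewrite distrC.
by rewrite -complexReN -complexReD; exact: cabs_ge_Re.
Qed.

Lemma continuous_Im : continuous (fun z : C => complex.Im z : R^o).
Proof.
move=> z; apply/(@cvgrPdist_lt R R^o C (nbhs z)) => e e0; apply/nbhs_cabsP; exists e => // w.
apply: le_lt_trans; rewrite distrC.
by rewrite -complexImN -complexImD; exact: cabs_ge_Im.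
Qed.

Lemma continuous_cabs : continuous (fun z : C => cabs z : R^o).
Proof.
move=> z; apply/(@cvgrPdist_lt R R^o C (nbhs z)) => e e0; apply/nbhs_cabsP; exists e => // w.
apply: le_lt_trans; rewrite ler_norml cabsBC cabsB_ge lerNl opprB andbT cabsBC.
exact: cabsB_ge.
Qed.

Lemma continuous_real_complex : continuous (fun x : R => x%:C : C).
Proof.
move=> x; apply/(@cvg_cabsP R (nbhs x)) => e e0; near=> y.
rewrite -rmorphB cabs_real distrC.
near: y.
exact: (@cvgr_dist_lt R R^o _ _ _ id x).
Unshelve. all: by end_near. Qed.

Section ContinuityAlgebra.
Variables (T : topologicalType) (F G : T -> C) (x : T).

Lemma continuousC_cst (k : C) : {for x, continuous (fun _ : T => k)}.
Proof. exact: cvg_cst. Qed.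

Hypotheses (cF : {for x, continuous F}) (cG : {for x, continuous G}).

Lemma continuousCD : {for x, continuous (fun y => F y + G y : C)}.
Proof. exact: (cvgD cF cG). Qed.

Lemma continuousCN : {for x, continuous (fun y => - F y : C)}.
Proof. exact: (cvgN cF). Qed.

Lemma continuousCB : {for x, continuous (fun y => F y - G y : C)}.
Proof. exact: (cvgB cF cG). Qed.

Lemma continuousCM : {for x, continuous (fun y => F y * G y : C)}.
Proof. exact: (cvgM cF cG). Qed.

Lemma continuousCV : F x != 0 -> {for x, continuous (fun y => (F y)^-1 : C)}.
Proof. by move=> Fx; exact: (cvgV Fx cF). Qed.

End ContinuityAlgebra.

(** Multiplying out the difference quotient admits [h = 0] and gives the first-order expansion in
    the form that Goursat's argument consumes. *)
Lemma is_derive_cabsP (f : C -> C) (z l : C) :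
  is_derive z 1 f l <->
  forall e : R, 0 < e -> exists2 d : R, 0 < d &
    forall h, cabs h < d -> cabs (f (z + h) - f z - l * h) <= e * cabs h.
Proof.
pose q (h : C) : C := h^-1 *: ((f \o shift z) (h *: (1 : C)) - f z).
have quotE (h : C) : h != 0 -> q h - l = h^-1 * (f (z + h) - f z - l * h).
  move=> h0; rewrite mulrBr mulrCA mulVf// mulr1 /q /= [h *: 1]mulr1 (addrC h).
  by [].
split=> [[df dl] e e0|H].
  have /cvg_cabsP/(_ e e0) : q h @[h --> 0^'] --> l.
    by rewrite -dl; exact: df.
  move=> /nbhs_cabsP[d d0 Hd]; exists d => // h hd.
  have [->|h0] := eqVneq h 0; first by rewrite mulr0 subr0 addr0 subrr cabs0 mulr0.
  have := Hd h; rewrite subr0 => /(_ hd h0)/ltW.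
    rewrite quotE//.
  by rewrite cabsM cabsV ler_pdivrMl ?cabs_gt0// (mulrC _ e).
have cvgf : q h @[h --> 0^'] --> l.
  apply/cvg_cabsP => e e0; apply/nbhs_cabsP.
  (* The expansion is bounded non-strictly, so [e / 2] is used to reach the strict bound of the
     limit. *)
  have [d d0 Hd] := H _ (divr_gt0 e0 (ltr0Sn R 1)).
  exists d => // h; rewrite subr0 => /Hd {}Hd h0.
  rewrite quotE// cabsM cabsV ltr_pdivrMl ?cabs_gt0//.
  apply: (le_lt_trans Hd); rewrite mulrC ltr_pM2l ?cabs_gt0//; lra.
by split; [exact: cvgP cvgf | exact: cvg_lim cvgf].
Qed.

End Topology.

(** * Integrals of complex-valued functions *)

Section ComplexIntegral.
Variable R : realType.
Local Notation C := (R[i]^o).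
Local Notation mu := (@lebesgue_measure R).
Implicit Types (a b c x : R) (F G : R -> C).

Definition cint a b F : C :=
  (\int[mu]_(x in `[a, b]) complex.Re (F x))
  +i* (\int[mu]_(x in `[a, b]) complex.Im (F x)).

Lemma continuous_itv_integrable (f : R -> R) a b :
  {in `[a, b], continuous f} -> mu.-integrable `[a, b] (EFin \o f).
Proof.
move=> cf; apply: continuous_compact_integrable; first exact: segment_compact.
by apply: continuous_in_subspaceT => x /set_mem; exact: cf.
Qed.

Lemma continuous_Re_comp F x : {for x, continuous F} ->
  {for x, continuous (fun x => complex.Re (F x) : R)}.
Proof. by move=> cF; exact: (continuous_comp cF (@continuous_Re R _)). Qed.

Lemma continuous_Im_comp F x : {for x, continuous F} ->
  {for x, continuous (fun x => complex.Im (F x) : R)}.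
Proof. by move=> cF; exact: (continuous_comp cF (@continuous_Im R _)). Qed.

Lemma continuous_cabs_comp F x : {for x, continuous F} ->
  {for x, continuous (fun x => cabs (F x) : R)}.
Proof. by move=> cF; exact: (continuous_comp cF (@continuous_cabs R _)). Qed.

Lemma integrable_Re F a b : {in `[a, b], continuous F} ->
  mu.-integrable `[a, b] (EFin \o (fun x => complex.Re (F x))).
Proof.
move=> cF; apply: continuous_itv_integrable => x /cF.
exact: continuous_Re_comp.
Qed.

Lemma integrable_Im F a b : {in `[a, b], continuous F} ->
  mu.-integrable `[a, b] (EFin \o (fun x => complex.Im (F x))).
Proof.
move=> cF; apply: continuous_itv_integrable => x /cF.
exact: continuous_Im_comp.
Qed.

Lemma integrable_cabs F a b : {in `[a, b], continuous F} ->
  mu.-integrable `[a, b] (EFin \o (fun x => cabs (F x))).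
Proof.
move=> cF; apply: continuous_itv_integrable => x /cF.
exact: continuous_cabs_comp.
Qed.

Lemma eq_cint a b F G : {in `[a, b], F =1 G} -> cint a b F = cint a b G.
Proof.
by move=> FG; rewrite /cint; congr (_ +i* _);
  apply: eq_Rintegral => x; rewrite inE => /FG ->.
Qed.

Lemma cintD a b F G :
  {in `[a, b], continuous F} -> {in `[a, b], continuous G} ->
  cint a b (fun x => F x + G x) = cint a b F + cint a b G.
Proof.
move=> cF cG; apply/eqP; rewrite eq_complex /=; apply/andP; split; apply/eqP.
  rewrite -RintegralD//; [|exact: integrable_Re..].
  by apply: eq_Rintegral => x _; rewrite complexReD.
rewrite -RintegralD//; [|exact: integrable_Im..].
by apply: eq_Rintegral => x _; rewrite complexImD.
Qed.

Lemma cintZ a b (k : C) F : {in `[a, b], continuous F} ->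
  cint a b (fun x => k * F x) = k * cint a b F.
Proof.
move=> cF; have iR := integrable_Re cF; have iI := integrable_Im cF.
have iZR (r : R) : mu.-integrable `[a, b] (EFin \o (fun x => r * complex.Re (F x))).
  exact: (integrableZl _ r iR).
have iZI (r : R) : mu.-integrable `[a, b] (EFin \o (fun x => r * complex.Im (F x))).
  exact: (integrableZl _ r iI).
apply/eqP; rewrite eq_complex complexReM complexImM /=; apply/andP; split; apply/eqP.
  rewrite -!RintegralZl// -RintegralB//.
  by apply: eq_Rintegral => x _; rewrite complexReM.
rewrite -!RintegralZl// -RintegralD//.
by apply: eq_Rintegral => x _; rewrite complexImM.
Qed.

Lemma cintN a b F : {in `[a, b], continuous F} ->
  cint a b (fun x => - F x) = - cint a b F.
Proof.
move=> cF; rewrite -mulN1r -cintZ//.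
by apply: eq_cint => x _; rewrite mulN1r.
Qed.

Lemma cintB a b F G :
  {in `[a, b], continuous F} -> {in `[a, b], continuous G} ->
  cint a b (fun x => F x - G x) = cint a b F - cint a b G.
Proof.
move=> cF cG; have cNG : {in `[a, b], continuous (fun x => - G x : C)}.
  by move=> x /cG; exact: continuousCN.
by rewrite (cintD cF cNG) cintN.
Qed.

Lemma cint_cst a b (k : C) : a <= b -> cint a b (fun=> k) = k * (b - a)%:C.
Proof.
move=> ab; rewrite /cint !Rintegral_cst//.
have -> : fine (mu `[a, b]) = b - a.
  rewrite lebesgue_measure_itv /= lte_fin; case: ltP => //= ba.
  by apply/esym/eqP; rewrite subr_eq0 eq_le ba ab.
by apply/eqP; rewrite eq_complex complexReM complexImM /= !mulr0 subr0 add0r !eqxx.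
Qed.

Lemma Rintegral_itv_cst (a b k : R) : a <= b ->
  \int[mu]_(x in `[a, b]) k = k * (b - a).
Proof.
move=> ab; have := @cint_cst a b k%:C ab => /(congr1 (@complex.Re R)) /=.
by rewrite mul0r subr0.
Qed.

Lemma cint_point a F : cint a a F = 0.
Proof. by rewrite /cint set_itv1 !Rintegral_set1. Qed.

Lemma cint_conj a b F : {in `[a, b], continuous F} ->
  cint a b (fun x => conjc (F x)) = conjc (cint a b F).
Proof.
move=> cF; apply/eqP; rewrite eq_complex /=; apply/andP; split; apply/eqP.
  by apply: eq_Rintegral => x _; case: (F x).
rewrite -mulN1r -RintegralZl//; last exact: integrable_Im.
by apply: eq_Rintegral => x _; rewrite mulN1r; case: (F x).
Qed.

Lemma Rintegral_itv_cat (f : R -> R) a c b : a <= c <= b ->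
  {in `[a, b], continuous f} ->
  \int[mu]_(x in `[a, b]) f x =
  \int[mu]_(x in `[a, c]) f x + \int[mu]_(x in `[c, b]) f x.
Proof.
move=> /andP[ac cb] cf; have fi := continuous_itv_integrable cf.
have := Rintegral_itvB fi (x := c); rewrite !bnd_simp => /(_ ac cb)/eqP.
rewrite subr_eq addrC => /eqP ->; congr (_ + _).
rewrite Rintegral_itv_obnd_cbnd//; apply: integrableS fi => //.
by move=> x /=; rewrite !in_itv/= => /andP[/ltW cx ->]; rewrite (le_trans ac).
Qed.

Lemma cint_cat F a c b : a <= c <= b -> {in `[a, b], continuous F} ->
  cint a b F = cint a c F + cint c b F.
Proof.
move=> acb cF; rewrite /cint !(@Rintegral_itv_cat _ a c b)// => x /cF.
- exact: continuous_Im_comp.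
- exact: continuous_Re_comp.
Qed.

(** Real and imaginary parts are estimated separately, each by the integral of the modulus; hence
    the factor 2. *)
Lemma cabs_cint a b F : {in `[a, b], continuous F} ->
  cabs (cint a b F) <= 2 * \int[mu]_(x in `[a, b]) cabs (F x).
Proof.
move=> cF; have iA := integrable_cabs cF.
apply: (le_trans (cabs_le_ReIm _)); rewrite mulr_natl mulr2n lerD//=.
  have iR := integrable_Re cF.
  apply: le_trans (le_normr_Rintegral _ iR) _ => //.
  apply: le_Rintegral => // [|x _]; last exact: cabs_ge_Re.
  exact: (integrable_norm iR).
have iI := integrable_Im cF.
apply: le_trans (le_normr_Rintegral _ iI) _ => //.
apply: le_Rintegral => // [|x _]; last exact: cabs_ge_Im.
exact: (integrable_norm iI).
Qed.

Lemma cabs_cint_bound a b F (M : R) : a <= b -> {in `[a, b], continuous F} ->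
  (forall x, x \in `[a, b] -> cabs (F x) <= M) ->
  cabs (cint a b F) <= 2 * (M * (b - a)).
Proof.
move=> ab cF FM; apply: (le_trans (cabs_cint cF)).
rewrite ler_pM2l//.
rewrite -Rintegral_itv_cst//.
apply: le_Rintegral => //; first exact: integrable_cabs.
by apply: continuous_itv_integrable => x _; exact: cvg_cst.
Qed.

(** The variable is real while [C] is used as a normed module over [R[i]], so the derivative is
    prescribed by components. *)
Lemma cint_FTC a b F (f : R -> C) : a <= b ->
  {in `[a, b], continuous f} ->
  (forall x, is_derive x 1 (fun x => complex.Re (F x)) (complex.Re (f x))) ->
  (forall x, is_derive x 1 (fun x => complex.Im (F x)) (complex.Im (f x))) ->
  cint a b f = F b - F a.
Proof.
rewrite le_eqVlt => /predU1P[<- _ _ _|ab cf dR dI].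
  by rewrite cint_point subrr.
have ftc (g h : R -> R) : {in `[a, b], continuous g} ->
    (forall x, is_derive x 1 h (g x)) -> \int[mu]_(x in `[a, b]) g x = h b - h a.
  move=> cg dh; rewrite /Rintegral (@continuous_FTC2 _ g h)//.
  - by apply: continuous_in_subspaceT => x /set_mem; exact: cg.
  - have ch x : {for x, continuous h}.
      by apply/differentiable_continuous/derivable1_diffP.
    split; first by [].
    + by apply: cvg_at_right_filter; exact: ch.
    + by apply: cvg_at_left_filter; exact: ch.
  - by move=> x _; rewrite derive1E derive_val.
rewrite /cint (ftc _ _ _ dR); last by move=> x /cf; exact: continuous_Re_comp.
rewrite (ftc _ _ _ dI); last by move=> x /cf; exact: continuous_Im_comp.
by case: (F a) (F b) => [? ?] [? ?].
Qed.

End ComplexIntegral.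

(** * Vanishing of a subadditive function of rectangles *)

Section Bisection.
Variables (R : realType) (Phi : R * R -> R * R -> R) (I0 J0 : R * R).

Let mid (I : R * R) := (I.1 + I.2) / 2.
Let lo (I : R * R) := (I.1, mid I).
Let hi (I : R * R) := (mid I, I.2).
Let sub (I J : R * R) := [/\ J.1 <= I.1, I.1 <= I.2 & I.2 <= J.2].
Let len (I : R * R) := I.2 - I.1.

Hypothesis Phi_split : forall I J, sub I I0 -> sub J J0 ->
  Phi I J <= Phi (lo I) (lo J) + Phi (lo I) (hi J)
             + Phi (hi I) (lo J) + Phi (hi I) (hi J).
Hypothesis Phi_local : forall x y, I0.1 <= x <= I0.2 -> J0.1 <= y <= J0.2 ->
  forall e, 0 < e -> exists2 d, 0 < d &
    forall I J, sub I I0 -> sub J J0 -> I.1 <= x <= I.2 -> J.1 <= y <= J.2 ->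
      len I < d -> len J < d -> Phi I J <= e * (len I + len J) ^+ 2.

(** Choice of a quarter that carries at least a fourth of [Phi]. The last quarter is not tested:
    subadditivity forces it when the other three fail. *)
Let step (q : (R * R) * (R * R)) :=
  let: (U, V) := q in
  if Phi U V <= 4 * Phi (lo U) (lo V) then (lo U, lo V)
  else if Phi U V <= 4 * Phi (lo U) (hi V) then (lo U, hi V)
  else if Phi U V <= 4 * Phi (hi U) (lo V) then (hi U, lo V)
  else (hi U, hi V).

Let q n := iter n step (I0, J0).

Let half I J := J = lo I \/ J = hi I.

Let half_sub I J : I.1 <= I.2 -> half I J -> sub J I /\ len J = len I / 2.
Proof.
move=> I12 [|] ->; rewrite /sub /len /lo /hi /mid /=; do ?split; lra.
Qed.

Let stepP I J : sub I I0 -> sub J J0 ->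
  [/\ half I (step (I, J)).1, half J (step (I, J)).2 &
    Phi I J <= 4 * Phi (step (I, J)).1 (step (I, J)).2].
Proof.
move=> sI sJ; have h := Phi_split sI sJ; rewrite /step.
case: (leP (Phi I J)) => [h1|h1]; first by split; [left|left|exact: h1].
case: (leP (Phi I J)) => [h2|h2]; first by split; [left|right|exact: h2].
case: (leP (Phi I J)) => [h3|h3]; first by split; [right|left|exact: h3].
split; [by right|by right|] => /=; lra.
Qed.

(** After [n] steps [Phi] has dropped at most by the factor [4 ^ n], and the square of the sum of
    the side lengths has dropped by exactly this factor. [Phi_local] at the common point of the
    nested rectangles then contradicts a positive value. *)
Lemma bisection_vanish : I0.1 <= I0.2 -> J0.1 <= J0.2 -> Phi I0 J0 <= 0.
Proof.
move=> I012 J012; rewrite leNgt; apply/negP => Phi0.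
have inv n : [/\ sub (q n).1 I0, sub (q n).2 J0,
    len (q n).1 = len I0 / 2 ^+ n, len (q n).2 = len J0 / 2 ^+ n &
    Phi I0 J0 <= 4 ^+ n * Phi (q n).1 (q n).2].
  elim: n => [|n [sI sJ lI lJ hP]].
    by rewrite /sub !expr0 !divr1 mul1r; split.
  have [hI hJ hP'] := stepP sI sJ.
  rewrite -surjective_pairing in hI hJ hP'.
  rewrite -[step (q n)]/(q n.+1) in hI hJ hP'.
  have [sI' lI'] := half_sub (let: And3 _ h _ := sI in h) hI.
  have [sJ' lJ'] := half_sub (let: And3 _ h _ := sJ in h) hJ.
  split.
  - by move: sI sI' => [? ? ?] [? ? ?]; split=> //; lra.
  - by move: sJ sJ' => [? ? ?] [? ? ?]; split=> //; lra.
  - by rewrite lI' lI exprSr invfM mulrA.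
  - by rewrite lJ' lJ exprSr invfM mulrA.
  - apply: (le_trans hP); rewrite exprSr -mulrA ler_pM2l// exprn_gt0//.
have mono n : sub (q n.+1).1 (q n).1 /\ sub (q n.+1).2 (q n).2.
  have [sI sJ _ _ _] := inv n.
  have [hI hJ _] := stepP sI sJ.
  rewrite -surjective_pairing -[step (q n)]/(q n.+1) in hI hJ.
  by have [] := half_sub (let: And3 _ h _ := sI in h) hI;
    have [] := half_sub (let: And3 _ h _ := sJ in h) hJ.
(* Nested closed intervals share the supremum of their left ends. *)
have point (I : nat -> R * R) : (forall n, sub (I n.+1) (I n)) ->
    (forall n, (I n).1 <= (I n).2) ->
    exists x, forall n, (I n).1 <= x <= (I n).2.
  move=> sI I12.
  have m1 : {homo (fun n => (I n).1) : m n / (m <= n)%N >-> m <= n}.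
    by apply: homo_leq => // [y x z|n]; [exact: le_trans|have [] := sI n].
  have m2 : {homo (fun n => (I n).2) : m n / (m <= n)%N >-> n <= m}.
    apply: (@homo_leq _ (fun n => (I n).2) (fun x y => y <= x)) => //.
      by move=> y x z h1 h2; exact: le_trans h2 h1.
    by move=> n; have [] := sI n.
  have ub n : ubound (range (fun n => (I n).1)) (I n).2.
    move=> _ [m _ <-]; apply: le_trans (m1 m (maxn m n) (leq_maxl _ _)) _.
    exact: le_trans (I12 _) (m2 n (maxn m n) (leq_maxr _ _)).
  exists (sup (range (fun n => (I n).1))) => n; apply/andP; split.
    by apply: ub_le_sup; [exists (I 0%N).2; exact: ub|exists n].
  by apply: ge_sup; [exists (I 0%N).1; exists 0%N|exact: ub].
have [x xq] := point (fun n => (q n).1) (fun n => (mono n).1)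
  (fun n => let: And5 (And3 _ h _) _ _ _ _ := inv n in h).
have [y yq] := point (fun n => (q n).2) (fun n => (mono n).2)
  (fun n => let: And5 _ (And3 _ h _) _ _ _ := inv n in h).
(* The summand 1 keeps [L] positive for degenerate intervals. With the tolerance
   [Phi I0 J0 / (2 * L ^+ 2)] the final chain bounds [Phi I0 J0] by its half. *)
pose L := len I0 + len J0 + 1.
have lI0 : 0 <= len I0 by rewrite /len; lra.
have lJ0 : 0 <= len J0 by rewrite /len; lra.
have L0 : 0 < L by rewrite /L; lra.
have e0 : 0 < Phi I0 J0 / (2 * L ^+ 2) by rewrite divr_gt0// mulr_gt0// exprn_gt0.
have [d d0 loc] := Phi_local (xq 0%N) (yq 0%N) e0.
have [n Ln] : exists n, L / 2 ^+ n < d.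
  have : (fun n : nat => L * (2^-1) ^+ n) @ \oo --> L * 0.
    apply: cvgMr; apply: cvg_expr; rewrite ger0_norm ?invr_ge0//; lra.
  rewrite mulr0 => /cvgrPdist_lt/(_ _ d0) [n _ /(_ n (leqnn n))].
  rewrite /= sub0r normrN exprVn ger0_norm ?divr_ge0 ?exprn_ge0//; last exact: ltW.
  by exists n.
have [sI sJ lI lJ hP] := inv n.
have p2 : 0 < (2 : R) ^+ n by rewrite exprn_gt0.
have lIL : len (q n).1 <= L / 2 ^+ n.
  by rewrite lI ler_pM2r ?invr_gt0// /L; lra.
have lJL : len (q n).2 <= L / 2 ^+ n.
  by rewrite lJ ler_pM2r ?invr_gt0// /L; lra.
have := loc _ _ sI sJ (xq n) (yq n) (le_lt_trans lIL Ln) (le_lt_trans lJL Ln).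
rewrite lI lJ -mulrDl expr_div_n -exprM.
rewrite -(ler_pM2l (exprn_gt0 n (ltr0Sn R 3))) => hn.
have {hP hn} := le_trans hP hn.
have -> : (4 : R) ^+ n = 2 ^+ (n * 2).
  by rewrite mulnC exprM; congr (_ ^+ _); ring.
rewrite mulrCA (mulrCA (2 ^+ _)) mulfV ?mulr1; last by rewrite expf_neq0.
rewrite leNgt => /negP; apply.
have : (len I0 + len J0) ^+ 2 <= L ^+ 2.
  by rewrite ler_pXn2r// ?nnegrE /L; lra.
move=> /(ler_wpM2l (ltW e0))/le_lt_trans; apply.
have -> : Phi I0 J0 / (2 * L ^+ 2) * L ^+ 2 = Phi I0 J0 / 2.
  by field; rewrite gt_eqF.
lra.
Qed.

End Bisection.

(** * Cauchy theorem in radial coordinates *)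

Section RadialCauchy.
Variable R : realType.
Local Notation C := (R[i]^o).

Lemma derivable_continuousC (H : C -> C) (z : C) :
  derivable H z 1 -> {for z, continuous H}.
Proof. by move=> dH; exact/differentiable_continuous/derivable1_diffP. Qed.

Lemma continuous_itv_cabs_bounded (F : R -> C) (a b : R) : a <= b ->
  {in `[a, b], continuous F} ->
  exists2 M : R, 1 <= M & forall x, x \in `[a, b] -> cabs (F x) <= M.
Proof.
move=> ab cF.
have cN : {within `[a, b], continuous (fun x => cabs (F x) : R)}.
  apply: continuous_in_subspaceT => x /set_mem xab.
  exact: continuous_cabs_comp (cF _ xab).
have [m _ mP] := EVT_max ab cN.
exists (cabs (F m) + 1); first by rewrite lerDr cabs_ge0.
by move=> x /mP/le_trans; apply; rewrite lerDl.
Qed.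

Variables (H : C -> C) (c q : R -> C) (a b : R).
Hypotheses (ab : a <= b) (cc : {in `[a, b], continuous c})
  (cq : {in `[a, b], continuous q}).
(* This says that q = c' / c. *)
Hypothesis c_FTC : forall x y, a <= x -> x <= y -> y <= b ->
  cint x y (fun s => q s * c s) = c y - c x.
Hypothesis dH : forall (t y : R), 0 <= t <= 1 -> y \in `[a, b] ->
  derivable H (t%:C * c y) 1.
Hypothesis H_closed : forall t : R, 0 <= t <= 1 -> H (t%:C * c a) = H (t%:C * c b).

Let sub_itv (x y u v z : R) : x <= u -> v <= y -> z \in `[u, v] -> z \in `[x, y].
Proof. by rewrite !in_itv/= => xu vy /andP[uz zv]; apply/andP; split; lra. Qed.

(* The boundary integral over a rectangle of the pullback of K(w) dw / w under
   w = t c(y), which is the form K(w) (dt / t + q(y) dy). *)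
Let side1 (K : C -> C) (y : R) (I : R * R) :=
  cint I.1 I.2 (fun t : R => K (t%:C * c y) * (t%:C)^-1).
Let side2 (K : C -> C) (t : R) (J : R * R) :=
  cint J.1 J.2 (fun y : R => K (t%:C * c y) * q y).
Let contour (K : C -> C) (I J : R * R) :=
  side1 K J.1 I + side2 K I.2 J - side1 K J.2 I - side2 K I.1 J.

Let cont_on (K : C -> C) :=
  forall (t y : R), 0 <= t <= 1 -> y \in `[a, b] -> {for t%:C * c y, continuous K}.

Let cont1 K y (I : R * R) : cont_on K -> y \in `[a, b] -> 0 < I.1 -> I.2 <= 1 ->
  {in `[I.1, I.2], continuous (fun t : R => K (t%:C * c y) * (t%:C)^-1 : C)}.
Proof.
move=> cK yab I0 I1 t; rewrite in_itv/= => /andP[It tI].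
apply: continuousCM.
  apply: (@continuous_comp _ _ _ (fun t : R => t%:C * c y : C) K).
    apply: continuousCM; last exact: continuousC_cst.
    exact: continuous_real_complex.
  by apply: cK => //; apply/andP; split; lra.
apply: continuousCV; first exact: continuous_real_complex.
rewrite -(rmorph0 (real_complex R)) (inj_eq (@complexI R)) gt_eqF//; lra.
Qed.

Let cont2 K (t : R) (J : R * R) : cont_on K -> 0 <= t <= 1 -> a <= J.1 -> J.2 <= b ->
  {in `[J.1, J.2], continuous (fun y : R => K (t%:C * c y) * q y : C)}.
Proof.
move=> cK t01 aJ Jb y /(sub_itv aJ Jb) yab.
apply: continuousCM; last exact: cq.
apply: (@continuous_comp _ _ _ (fun y : R => t%:C * c y : C) K).
  apply: continuousCM; first exact: continuousC_cst.
  exact: cc.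
exact: cK.
Qed.

Let cont_H : cont_on H.
Proof. by move=> t y t01 yab; apply: derivable_continuousC; exact: dH. Qed.

Let t_neq0 (I : R * R) (t : R) : 0 < I.1 -> t \in `[I.1, I.2] -> t%:C != 0 :> C.
Proof.
move=> I0; rewrite in_itv/= => /andP[It _].
rewrite -(rmorph0 (real_complex R)) (inj_eq (@complexI R)) gt_eqF//; lra.
Qed.

Let contourD (K L : C -> C) (I J : R * R) : cont_on K -> cont_on L ->
  0 < I.1 -> I.1 <= I.2 -> I.2 <= 1 -> a <= J.1 -> J.1 <= J.2 -> J.2 <= b ->
  contour (fun w => K w + L w) I J = contour K I J + contour L I J.
Proof.
move=> cK cL I0 I12 I1 aJ J12 Jb.
have e1 y : y \in `[a, b] ->
    side1 (fun w => K w + L w) y I = side1 K y I + side1 L y I.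
  move=> yab; rewrite /side1 -cintD; [|exact: cont1..].
  by apply: eq_cint => t _; rewrite mulrDl.
have e2 t : 0 <= t <= 1 ->
    side2 (fun w => K w + L w) t J = side2 K t J + side2 L t J.
  move=> t01; rewrite /side2 -cintD; [|exact: cont2..].
  by apply: eq_cint => y _; rewrite mulrDl.
rewrite /contour !e1 ?e2 ?in_itv/=; [ring|apply/andP; split; lra..].
Qed.

(* Hence only the remainder of the first-order expansion of H contributes to the
   integral over a small rectangle. *)
Let contour_affine (k l : C) (I J : R * R) :
  0 < I.1 -> I.1 <= I.2 -> I.2 <= 1 -> a <= J.1 -> J.1 <= J.2 -> J.2 <= b ->
  contour (fun w => k + l * w) I J = 0.
Proof.
move=> I0 I12 I1 aJ J12 Jb.
have Jab y : y \in `[J.1, J.2] -> y \in `[a, b] by exact: sub_itv.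
have e1 y : side1 (fun w => k + l * w) y I =
    cint I.1 I.2 (fun t : R => k * (t%:C)^-1) + l * c y * (I.2 - I.1)%:C.
  rewrite -cint_cst// -cintD; first last.
  - by move=> ? _; exact: continuousC_cst.
  - move=> t tI; apply: continuousCM; first exact: continuousC_cst.
    by apply: continuousCV; [exact: continuous_real_complex|exact: t_neq0 tI].
  by apply: eq_cint => t /(t_neq0 I0) t0 /=; field.
have e2 (t : R) : side2 (fun w => k + l * w) t J =
    k * cint J.1 J.2 q + l * t%:C * (c J.2 - c J.1).
  have cqc : {in `[J.1, J.2], continuous (fun y : R => q y * c y : C)}.
    by move=> y /Jab yab; apply: continuousCM; [exact: cq|exact: cc].
  have cqJ : {in `[J.1, J.2], continuous q} by move=> y /Jab; exact: cq.
  rewrite -c_FTC// -!cintZ// -cintD; first last.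
  - by move=> y /cqc; apply: continuousCM; exact: continuousC_cst.
  - by move=> y /cqJ; apply: continuousCM; exact: continuousC_cst.
  by apply: eq_cint => y _ /=; ring.
(* The part of [k] is the same on opposite sides. For [l * w] the two pairs of sides give
   [l (I.2 - I.1) (c J.2 - c J.1)] with opposite signs. *)
rewrite /contour !e1 !e2 rmorphB /=; ring.
Qed.

(** The factor 4 is two opposite sides times the 2 of [cabs_cint_bound]; [d^-1] bounds the density
    [1 / t] and [M] bounds [q]. *)
Let contour_bound (K : C -> C) (e d M : R) (I J : R * R) : cont_on K ->
  0 < d -> d <= I.1 -> I.1 <= I.2 -> I.2 <= 1 ->
  a <= J.1 -> J.1 <= J.2 -> J.2 <= b -> 0 <= e ->
  (forall y, y \in `[a, b] -> cabs (q y) <= M) ->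
  (forall t y, t \in `[I.1, I.2] -> y \in `[J.1, J.2] ->
    cabs (K (t%:C * c y)) <= e) ->
  cabs (contour K I J) <=
    4 * e * (d^-1 * (I.2 - I.1) + M * (J.2 - J.1)).
Proof.
move=> cK d0 dI I12 I1 aJ J12 Jb e0 qM KE.
have I0 := lt_le_trans d0 dI.
have Jab y : y \in `[J.1, J.2] -> y \in `[a, b] by exact: sub_itv.
have s1 y : y \in `[J.1, J.2] ->
    cabs (side1 K y I) <= 2 * (e * d^-1 * (I.2 - I.1)).
  move=> yJ; apply: cabs_cint_bound I12 (cont1 cK (Jab _ yJ) I0 I1) _.
  move=> t tI; rewrite cabsM ler_pM ?cabs_ge0//; first exact: KE.
  rewrite cabsV cabs_real; move: tI; rewrite in_itv/= => /andP[It _].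
  have dt : d <= t by lra.
  by rewrite lef_pV2 ?posrE//; rewrite ger0_norm//; lra.
have s2 t : t \in `[I.1, I.2] ->
    cabs (side2 K t J) <= 2 * (e * M * (J.2 - J.1)).
  move=> tI.
  have t01 : 0 <= t <= 1.
    by move: tI; rewrite in_itv/= => /andP[? ?]; apply/andP; split; lra.
  apply: cabs_cint_bound J12 (cont2 cK t01 aJ Jb) _.
  by move=> y yJ; rewrite cabsM ler_pM ?cabs_ge0//; [exact: KE|exact/qM/Jab].
have i1 : I.1 \in `[I.1, I.2] by rewrite in_itv/= lexx I12.
have i2 : I.2 \in `[I.1, I.2] by rewrite in_itv/= lexx I12.
have j1 : J.1 \in `[J.1, J.2] by rewrite in_itv/= lexx J12.
have j2 : J.2 \in `[J.1, J.2] by rewrite in_itv/= lexx J12.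
have := s1 _ j1; have := s1 _ j2; have := s2 _ i1; have := s2 _ i2.
rewrite /contour => h1 h2 h3 h4.
apply: le_trans (cabsB _ _) _.
have h5 := cabsB (side1 K J.1 I + side2 K I.2 J) (side1 K J.2 I).
have h6 := cabsD (side1 K J.1 I) (side2 K I.2 J).
apply: le_trans (lerD (le_trans h5 (lerD (le_trans h6 (lerD h4 h1)) h3)) h2) _.
by rewrite le_eqVlt; apply/orP; left; apply/eqP; ring.
Qed.

Let contour_split (I J : R * R) (m n : R) : 0 < I.1 -> I.1 <= m <= I.2 ->
  I.2 <= 1 -> a <= J.1 -> J.1 <= n <= J.2 -> J.2 <= b ->
  contour H I J = contour H (I.1, m) (J.1, n) + contour H (I.1, m) (n, J.2) +
    contour H (m, I.2) (J.1, n) + contour H (m, I.2) (n, J.2).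
Proof.
move=> I0 ImI I1 aJ JnJ Jb.
have e1 y : y \in `[a, b] -> side1 H y I = side1 H y (I.1, m) + side1 H y (m, I.2).
  by move=> yab; exact: cint_cat ImI (cont1 cont_H yab I0 I1).
have e2 (t : R) : 0 <= t <= 1 ->
    side2 H t J = side2 H t (J.1, n) + side2 H t (n, J.2).
  by move=> t01; exact: cint_cat JnJ (cont2 cont_H t01 aJ Jb).
move: ImI JnJ => /andP[? ?] /andP[? ?].
rewrite /contour /= !e1 ?e2 ?in_itv/=; [ring|apply/andP; split; lra..].
Qed.

(** Near [(t0, y0)] the function [H] differs from its tangent at [w0] by at most a small multiple of
    the distance to [w0], hence of the size [D] of the rectangle. Integration along the sides
    contributes a second factor [D], which is the quadratic smallness that bisection needs. *)
Let contour0 (d : R) : 0 < d -> d <= 1 -> contour H (d, 1) (a, b) = 0.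
Proof.
move=> d0 d1.
have [B B1 cB] := continuous_itv_cabs_bounded ab cc.
have [M M1 qM] := continuous_itv_cabs_bounded ab cq.
suff : cabs (contour H (d, 1) (a, b)) <= 0.
  by rewrite le_eqVlt ltNge cabs_ge0 orbF cabs_eq0 => /eqP.
apply: (@bisection_vanish R (fun I J => cabs (contour H I J)) (d, 1) (a, b)) => //=.
  move=> I J [I1 I12 I2] [J1 J12 J2]; rewrite /= in I1 I2 J1 J2.
  rewrite (contour_split (m := (I.1 + I.2) / 2) (n := (J.1 + J.2) / 2)); first last.
  - lra.
  - apply/andP; split; lra.
  - lra.
  - lra.
  - apply/andP; split; lra.
  - lra.
  do 2 (apply: le_trans (cabsD _ _) _; rewrite lerD2r).
  exact: cabsD.
move=> t0 y0 t0I y0J e e0; have [t0d t01] := andP t0I.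
have t001 : 0 <= t0 <= 1 by apply/andP; split; lra.
have y0ab : y0 \in `[a, b] by rewrite in_itv/=.
pose w0 : C := t0%:C * c y0.
(* A Lipschitz constant of [t%:C * c y] in [(t, y)]: [B] for the variation of [t], and [2 * M * B]
   for that of [c], by [c_FTC]. [K] gathers the constants of [contour_bound], so that the tolerance
   [e / K] ends in exactly [e * D ^+ 2]. *)
pose L := B + 2 * M * B.
have L0 : 0 < L by rewrite /L addr_gt0 ?mulr_gt0//; lra.
pose K := 4 * L * (d^-1 + M).
have K0 : 0 < K by rewrite mulr_gt0// ?mulr_gt0// addr_gt0 ?invr_gt0//; lra.
have [dl dl0 Hdl] := ((is_derive_cabsP H w0 _).1 (derivableP (dH t001 y0ab)))
  _ (divr_gt0 e0 K0).
have MB : 0 <= M * B by apply: mulr_ge0; lra.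
have MB2 : 0 <= 2 * M * B by rewrite -mulrA mulr_ge0.
have w_close (I J : R * R) t y : d <= I.1 -> I.2 <= 1 -> a <= J.1 -> J.2 <= b ->
    I.1 <= t0 <= I.2 -> J.1 <= y0 <= J.2 ->
    t \in `[I.1, I.2] -> y \in `[J.1, J.2] ->
    cabs (t%:C * c y - w0) <= L * (I.2 - I.1 + (J.2 - J.1)).
  move=> dI I1 aJ Jb /andP[It0 t0I'] /andP[Jy0 y0J'] /[!in_itv]/= /andP[It tI].
  move=> /andP[Jy yJ].
  have cL x y' : a <= x -> x <= y' -> y' <= b ->
      cabs (c y' - c x) <= 2 * (M * B * (y' - x)).
    move=> ax xy yb; rewrite -c_FTC//; apply: cabs_cint_bound => [//|z|z].
      move=> /(sub_itv ax yb) zab; apply: continuousCM; [exact: cq|exact: cc].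
    move=> /(sub_itv ax yb) zab; rewrite cabsM ler_pM ?cabs_ge0//.
      exact: qM.
    exact: cB.
  have cyy : cabs (c y - c y0) <= 2 * (M * B * (J.2 - J.1)).
    have [yy|/ltW yy] := leP y0 y.
      apply: le_trans (cL _ _ _ yy _) _; [lra..|].
      by rewrite ler_pM2l// ler_wpM2l//; lra.
    rewrite cabsBC; apply: le_trans (cL _ _ _ yy _) _; [lra..|].
    by rewrite ler_pM2l// ler_wpM2l//; lra.
  have -> : t%:C * c y - w0 = (t - t0)%:C * c y + t0%:C * (c y - c y0).
    by rewrite /w0 rmorphB /=; ring.
  apply: le_trans (cabsD _ _) _; rewrite !cabsM !cabs_real.
  have h1 : `|t - t0| * cabs (c y) <= (I.2 - I.1) * B.
    rewrite ler_pM ?cabs_ge0//; last by apply: cB; rewrite in_itv/=; apply/andP; split; lra.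
    by rewrite ler_norml; apply/andP; split; lra.
  have h2 : `|t0| * cabs (c y - c y0) <= 1 * (2 * (M * B * (J.2 - J.1))).
    by rewrite ler_pM ?cabs_ge0// ger0_norm//; lra.
  have h3 : 0 <= (I.2 - I.1) * (2 * M * B).
    by apply: mulr_ge0; [lra|exact: MB2].
  have h4 : 0 <= B * (J.2 - J.1) by apply: mulr_ge0; lra.
  apply: le_trans (lerD h1 h2) _; rewrite /L mul1r -subr_ge0.
  by rewrite (_ : _ - _ = (I.2 - I.1) * (2 * M * B) + B * (J.2 - J.1)) ?addr_ge0//; ring.
exists (dl / (2 * L)); first by rewrite divr_gt0 ?mulr_gt0.
move=> I J [I1 I12 I2] [J1 J12 J2] t0I' y0J' lI lJ; rewrite /= in I1 I2 J1 J2.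
set D := I.2 - I.1 + (J.2 - J.1) in w_close *.
have D0 : 0 <= D by rewrite /D; lra.
have LD : L * D < dl.
  have -> : dl = L * (dl / (2 * L) + dl / (2 * L)) by field; rewrite gt_eqF.
  by rewrite ltr_pM2l// /D; lra.
have eK0 : 0 <= e / K by rewrite divr_ge0// ltW.
have LD0 : 0 <= L * D by rewrite mulr_ge0// ltW.
set l := 'D_1 H w0 in Hdl.
pose A (w : C) : C := (H w0 - l * w0) + l * w.
have cA : cont_on A.
  move=> t y _ _; rewrite /A; apply: (@continuousCD R C); first exact: continuousC_cst.
  by apply: (@continuousCM R C); [exact: continuousC_cst|exact: cvg_id].
have cE : cont_on (fun w => H w - A w).
  by move=> t y t01' yab; apply: (@continuousCB R C); [exact: cont_H|exact: cA].
have -> : contour H I J = contour (fun w => H w - A w) I J.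
  rewrite -[RHS]addr0 -(@contour_affine (H w0 - l * w0) l I J (lt_le_trans d0 I1) I12 I2 J1 J12 J2).
  rewrite -(contourD cE cA (lt_le_trans d0 I1) I12 I2 J1 J12 J2).
  by congr (contour _ I J); apply/funext => w; rewrite subrK.
apply: le_trans (contour_bound (e := e / K * (L * D)) cE d0 I1 I12 I2 J1 J12 J2 _ qM _) _.
- exact: mulr_ge0.
- move=> t y tI yJ.
  have hc := w_close I J t y I1 I2 J1 J2 t0I' y0J' tI yJ.
  have := Hdl (t%:C * c y - w0) (le_lt_trans hc LD).
  have -> : w0 + (t%:C * c y - w0) = t%:C * c y by rewrite addrC subrK.
  move=> h.
  have -> : H (t%:C * c y) - A (t%:C * c y) =
    H (t%:C * c y) - H w0 - l * (t%:C * c y - w0) by rewrite /A; ring.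
  by apply: (le_trans h); rewrite ler_pM2l ?divr_gt0.
have -> : e * D ^+ 2 = 4 * (e / K * (L * D)) * ((d^-1 + M) * D).
  rewrite -{1}(divfK (lt0r_neq0 K0) e).
  by move: (e / K) => f; rewrite /K; ring.
rewrite ler_wpM2l//.
  by apply: mulr_ge0 => //; exact: mulr_ge0.
have di : 0 <= d^-1 by rewrite invr_ge0 ltW.
have h1 : 0 <= d^-1 * (J.2 - J.1) by rewrite mulr_ge0//; lra.
have h2 : 0 <= M * (I.2 - I.1) by rewrite mulr_ge0//; lra.
rewrite /D; lra.
Qed.

(** By [H_closed] the sides [y = a] and [y = b] cancel in [contour0], so the integral over [y] at
    height [t = d] does not depend on [d]. As [d] tends to 0, [H (d%:C * c y)] tends to [H 0]
    uniformly in [y]. *)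
Lemma radial_cauchy :
  cint a b (fun y => H (c y) * q y) = H 0 * cint a b q.
Proof.
have side0 (d : R) : 0 < d -> d <= 1 -> side2 H 1 (a, b) = side2 H d (a, b).
  move=> d0 d1; have := contour0 d0 d1; rewrite /contour /=.
  have -> : side1 H b (d, 1) = side1 H a (d, 1).
    apply: eq_cint => t /=; rewrite in_itv/= => /andP[dt t1].
    by rewrite H_closed//; apply/andP; split; lra.
  by rewrite (addrC (side1 _ _ _)) addrK => /eqP; rewrite subr_eq0 => /eqP.
have [B B1 cB] := continuous_itv_cabs_bounded ab cc.
have [M M1 qM] := continuous_itv_cabs_bounded ab cq.
have aab : a \in `[a, b] by rewrite in_itv/= lexx.
have z01 : 0 <= (0 : R) <= 1 by rewrite lexx /= ler01.
have cH0 : {for 0, continuous H}.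
  by have := cont_H z01 aab; rewrite mul0r.
have -> : cint a b (fun y => H (c y) * q y) = side2 H 1 (a, b).
  by apply: eq_cint => y _; rewrite mul1r.
apply/eqP; rewrite -subr_eq0 -cabs_eq0 eq_le cabs_ge0 andbT.
apply/ler_addgt0Pr => e e0; rewrite add0r.
(* The summand 1 keeps the denominator positive when [a = b]; the 2 comes from [cabs_cint_bound]. *)
pose e' := e / (2 * M * (b - a + 1)).
have M0 : 0 < M by lra.
have ba0 : 0 < b - a + 1 by rewrite ltr_wpDl ?subr_ge0.
have den0 : 0 < 2 * M * (b - a + 1) by rewrite mulr_gt0// mulr_gt0.
have e'0 : 0 < e' by rewrite divr_gt0.
have /(@cvg_cabsP _ C (nbhs 0))/(_ e' e'0)/nbhs_cabsP[r r0 Hr] := cH0.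
pose d := Num.min 1 (r / (2 * B)).
have d0 : 0 < d by rewrite lt_min ltr01 divr_gt0// mulr_gt0//; lra.
have d1 : d <= 1 by rewrite ge_min lexx.
have d01 : 0 <= d <= 1 by rewrite (ltW d0).
have c2 : {in `[a, b], continuous (fun y : R => H (d%:C * c y) * q y : C)}.
  by apply: (@cont2 H d (a, b)) => //; exact: cont_H.
have c0 : {in `[a, b], continuous (fun y : R => H 0 * q y : C)}.
  by move=> y yab; apply: continuousCM; [exact: continuousC_cst|exact: cq].
rewrite (side0 d d0 d1) -(cintZ (H 0) cq) /side2 /= -(cintB c2 c0).
have cB' : {in `[a, b], continuous (fun y : R => H (d%:C * c y) * q y - H 0 * q y : C)}.
  by move=> y yab; exact: (continuousCB (c2 y yab) (c0 y yab)).
apply: le_trans (cabs_cint_bound (M := e' * M) ab cB' _) _.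
  move=> y yab; rewrite -mulrBl cabsM ler_pM ?cabs_ge0 ?qM//.
  apply/ltW/Hr; rewrite subr0 cabsM cabs_real gtr0_norm//.
  apply: (@le_lt_trans _ _ (d * B)); first by rewrite ler_wpM2l ?cB ?(ltW d0).
  apply: (@le_lt_trans _ _ (r / (2 * B) * B)).
    by rewrite ler_wpM2r ?ge_min ?lexx ?orbT//; lra.
  have -> : r / (2 * B) * B = r / 2 by field; rewrite gt_eqF//; lra.
  lra.
have -> : e = 2 * (e' * M * (b - a + 1)) by rewrite /e'; field; lra.
by rewrite ler_pM2l// ler_wpM2l ?lerDl// mulr_ge0 ?(ltW e'0)//; lra.
Qed.

End RadialCauchy.

(** * Cauchy formula on circles *)

Section Circle.
Variable R : realType.
Local Notation C := (R[i]^o).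

Lemma derivable_affine_comp (f : C -> C) (z u w : C) :
  derivable f (z + u * w) 1 -> derivable (fun w => f (z + u * w)) w 1.
Proof.
move=> /derivableP; set l := 'D_1 f _ => /is_derive_cabsP df.
suff : is_derive w 1 (fun w => f (z + u * w)) (l * u) by move=> [].
apply/is_derive_cabsP => e e0.
(* Adding 1 avoids a separate case for [u = 0]. *)
have u0 : 0 < cabs u + 1 by rewrite ltr_wpDl ?cabs_ge0.
have [d d0 dP] := df _ (divr_gt0 e0 u0).
exists (d / (cabs u + 1)); first by rewrite divr_gt0.
move=> h; rewrite ltr_pdivlMr// => hd.
have uh : cabs (u * h) <= (cabs u + 1) * cabs h.
  by rewrite cabsM ler_wpM2r ?cabs_ge0// lerDl.
have /dP : cabs (u * h) < d by apply: le_lt_trans uh _; rewrite mulrC.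
have -> : z + u * w + u * h = z + u * (w + h) by rewrite mulrDr addrA.
rewrite mulrA => /le_trans; apply.
apply: (@le_trans _ _ (e / (cabs u + 1) * ((cabs u + 1) * cabs h))).
  by rewrite ler_wpM2l// divr_ge0 ?ltW.
by rewrite mulrA divfK ?gt_eqF.
Qed.

Definition expi (t : R) : C := cos t +i* sin t.

Lemma cabs_expi t : cabs (expi t) = 1.
Proof. by rewrite cabsE /= cos2Dsin2 sqrtr1. Qed.

Lemma expi_neq0 t : expi t != 0.
Proof. by rewrite -cabs_gt0 cabs_expi ltr01. Qed.

Lemma expi0 : expi 0 = 1.
Proof. by rewrite /expi cos0 sin0. Qed.

Lemma expi2pi : expi (2 * pi) = 1.
Proof. by rewrite /expi mulr_natl cos2pi sin2pi. Qed.

Lemma expi_conj t : conjc (expi t) = (expi t)^-1.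
Proof.
apply: (mulfI (expi_neq0 t)); rewrite divff ?expi_neq0//.
apply/eqP; rewrite eq_complex /= mulrN opprK -!expr2 cos2Dsin2 mulrN mulrC addNr.
by rewrite !eqxx.
Qed.

Lemma continuous_expi : continuous expi.
Proof.
move=> t; have -> : expi = fun t => (cos t)%:C + 'i * (sin t)%:C.
  by apply/funext => s; exact: complexE.
apply: (@continuousCD R R (fun t => (cos t)%:C) (fun t => 'i * (sin t)%:C)).
  exact: (continuous_comp (@continuous_cos R t) (@continuous_real_complex R _)).
apply: continuousCM; first exact: continuousC_cst.
exact: (continuous_comp (@continuous_sin R t) (@continuous_real_complex R _)).
Qed.

Lemma cabs_circle r t : 0 <= r -> cabs (r%:C * expi t) = r.
Proof. by move=> r0; rewrite cabsM cabs_real cabs_expi mulr1 ger0_norm. Qed.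

Lemma continuous_circle (r t : R) :
  {for t, continuous (fun t => r%:C * expi t : C)}.
Proof.
apply: continuousCM; first exact: continuousC_cst.
exact: continuous_expi.
Qed.

Lemma circle_neq (r : R) (a : C) t : cabs a < r -> r%:C * expi t - a != 0.
Proof.
move=> ar; rewrite -cabs_gt0; apply: lt_le_trans (cabsB_ge _ _).
rewrite cabs_circle ?subr_gt0//; apply: ltW; exact: le_lt_trans (cabs_ge0 _) ar.
Qed.

Let pi2_ge0 : 0 <= 2 * pi :> R.
Proof. by rewrite mulr_ge0// pi_ge0. Qed.

Section Kernel.
Variables (r : R) (a : C).
Hypothesis ar : cabs a < r.

Let r0 : 0 < r.
Proof. exact: le_lt_trans (cabs_ge0 _) ar. Qed.

(** With [zeta] the point of the circle, this is [dzeta / (i (zeta - a))] written as a density in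
    [t]; times ['i] it is the logarithmic derivative of [r%:C * expi t - a]. *)
Definition circle_kernel (t : R) : C := r%:C * expi t / (r%:C * expi t - a).

Lemma continuous_circle_kernel t : {for t, continuous circle_kernel}.
Proof.
rewrite /circle_kernel; apply: continuousCM; first exact: continuous_circle.
apply: continuousCV; last exact: circle_neq.
by apply: continuousCB; [exact: continuous_circle|exact: continuousC_cst].
Qed.

(** [radial_cauchy] for the circle seen from the off-centre point [z + a]; by convexity the rays
    from that point to the circle stay in the disc where [f] is derivable. *)
Lemma cauchy_circle_ratio (f : C -> C) (z : C) :
  (forall w, cabs (w - z) <= r -> derivable f w 1) ->
  cint 0 (2 * pi) (fun t => f (z + r%:C * expi t) * circle_kernel t) =
  f (z + a) * cint 0 (2 * pi) circle_kernel.
Proof.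
move=> df.
have cc : {in `[0, 2 * pi], continuous (fun t => r%:C * expi t - a : C)}.
  move=> t _.
  exact: (continuousCB (@continuous_circle r t) (@continuousC_cst R R t a)).
have cq : {in `[0, 2 * pi], continuous (fun t => 'i * circle_kernel t : C)}.
  move=> t _.
  exact: (continuousCM (@continuousC_cst R R t 'i) (@continuous_circle_kernel t)).
have c_FTC (x y : R) : 0 <= x -> x <= y -> y <= 2 * pi ->
    cint x y (fun s => 'i * circle_kernel s * (r%:C * expi s - a)) =
    (r%:C * expi y - a) - (r%:C * expi x - a).
  move=> _ xy _.
  have ci : {in `[x, y], continuous (fun t => 'i * (r%:C * expi t) : C)}.
    move=> t _.
    exact: (continuousCM (@continuousC_cst R R t 'i) (@continuous_circle r t)).
  have dR (t : R) : is_derive t 1 (fun t => complex.Re (r%:C * expi t - a))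
      (complex.Re ('i * (r%:C * expi t))).
    rewrite (_ : (fun t => _) = fun t => r * cos t - complex.Re a).
      apply: is_derive_eq.
      by rewrite !complexReM !complexImM /= /GRing.scale /=; ring.
    by apply/funext => s; rewrite complexReD complexReN complexReM /= mul0r subr0.
  have dI (t : R) : is_derive t 1 (fun t => complex.Im (r%:C * expi t - a))
      (complex.Im ('i * (r%:C * expi t))).
    rewrite (_ : (fun t => _) = fun t => r * sin t - complex.Im a).
      apply: is_derive_eq.
      by rewrite !complexImM !complexReM /= /GRing.scale /=; ring.
    by apply/funext => s; rewrite complexImD complexImN complexImM /= mul0r addr0.
  rewrite -(cint_FTC xy ci dR dI).
  by apply: eq_cint => t _; rewrite /circle_kernel -mulrA divfK ?circle_neq.
have dH (t y : R) : 0 <= t <= 1 -> y \in `[0, 2 * pi] ->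
    derivable (fun w : C => f (z + a + 1 * w)) (t%:C * (r%:C * expi y - a)) 1.
  move=> /andP[t0 t1] _; apply: derivable_affine_comp; apply: df.
  have -> : z + a + 1 * (t%:C * (r%:C * expi y - a)) - z =
    t%:C * (r%:C * expi y) + (1 - t)%:C * a by rewrite rmorphB /=; ring.
  apply: (le_trans (cabsD _ _)); rewrite (cabsM t%:C) (cabsM (1 - t)%:C) cabs_circle ?(ltW r0)//.
  rewrite !cabs_real !ger0_norm ?subr_ge0//.
  have : (1 - t) * cabs a <= (1 - t) * r by rewrite ler_wpM2l ?subr_ge0// ltW.
  lra.
have H_closed (t : R) : 0 <= t <= 1 ->
    f (z + a + 1 * (t%:C * (r%:C * expi 0 - a))) =
    f (z + a + 1 * (t%:C * (r%:C * expi (2 * pi) - a))).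
  by rewrite expi0 expi2pi.
have := radial_cauchy pi2_ge0 cc cq c_FTC dH H_closed.
have ck : {in `[0, 2 * pi], continuous circle_kernel}.
  by move=> t _; exact: continuous_circle_kernel.
have cf : {in `[0, 2 * pi], continuous (fun t => f (z + r%:C * expi t) * circle_kernel t : C)}.
  move=> t _.
  have czf : {for z + r%:C * expi t, continuous f}.
    apply: derivable_continuousC; apply: df.
    by rewrite addrC addKr cabs_circle// ltW.
  have cz := continuousCD (@continuousC_cst R R t z) (@continuous_circle r t).
  exact: (continuousCM (continuous_comp cz czf) (@continuous_circle_kernel t)).
rewrite (cintZ 'i ck) mulrCA mulr0 addr0.
rewrite (_ : cint _ _ _ = 'i * cint 0 (2 * pi)
  (fun t => f (z + r%:C * expi t) * circle_kernel t)).
  by apply: mulfI; rewrite -cabs_gt0 cabs_i.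
rewrite -(cintZ 'i cf); apply: eq_cint => t _ /=.
rewrite mul1r mulrCA; congr ('i * (f _ * _)); ring.
Qed.

End Kernel.

(** For a constant [f], [cauchy_circle_ratio] at [a] is a tautology and says nothing about the mass
    of the kernel. It is therefore applied at the centre, where the kernel is 1, to the conjugate of
    the kernel of [a]. *)
Lemma cint_circle_kernel (r : R) (a : C) : cabs a < r ->
  cint 0 (2 * pi) (circle_kernel r a) = (2 * pi)%:C.
Proof.
move=> ar; have r0 : 0 < r by exact: le_lt_trans (cabs_ge0 _) ar.
have rC : r%:C != 0 :> C by rewrite -cabs_gt0 cabs_real gtr0_norm.
have den (w : C) : cabs w <= r -> (r ^+ 2)%:C - conjc a * w != 0.
  move=> wr; rewrite -cabs_gt0; apply: lt_le_trans (cabsB_ge _ _).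
  rewrite cabs_real cabsM cabs_conj ger0_norm ?sqr_ge0// subr_gt0 expr2.
  apply: (@le_lt_trans _ _ (cabs a * r)); first by rewrite ler_wpM2l ?cabs_ge0.
  by rewrite ltr_pM2r.
(* On the circle conj (zeta / (zeta - a)) coincides with k(zeta), where k is
   holomorphic on the disc with k(0) = 1. *)
pose k (w : C) : C := (r ^+ 2)%:C * ((r ^+ 2)%:C - conjc a * w)^-1.
have dk (w : C) : cabs (w - 0) <= r -> derivable k w 1.
  rewrite subr0 => wr; apply: derivableM; first exact: derivable_cst.
  apply: derivableV; first exact: den.
  apply: derivableB; first exact: derivable_cst.
  by apply: derivableM; [exact: derivable_cst|exact: derivable_id].
have c0 : cabs (0 : C) < r by rewrite cabs0.
have K0 : circle_kernel r 0 = fun=> 1.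
  apply/funext => t; rewrite /circle_kernel subr0 divff//.
  by rewrite mulf_neq0// expi_neq0.
have := cauchy_circle_ratio c0 dk.
rewrite K0 cint_cst// subr0 mul1r addr0 => kE.
have ck : {in `[0, 2 * pi], continuous (circle_kernel r a)}.
  by move=> t _; exact: continuous_circle_kernel.
apply: (can_inj (@conjcK R)); rewrite -(cint_conj ck) conjc_real.
rewrite -[RHS]mul1r.
have <- : k 0 = 1.
  by rewrite /k mulr0 subr0 divff// rmorphXn /= expf_neq0.
rewrite -kE; apply: eq_cint => t _; rewrite mulr1 add0r /k /circle_kernel.
have cM (x y : R[i]) : conjc (x * y) = conjc x * conjc y by exact: rmorphM.
have cz : conjc (r%:C * expi t) = r%:C / expi t.
  by rewrite cM expi_conj; congr (_ / _); rewrite conjc_real.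
have cB (x y : R[i]) : conjc (x - y) = conjc x - conjc y by exact: rmorphB.
rewrite cM conjc_inv cB cz.
have E0 := expi_neq0 t; have D0 := den (r%:C * expi t).
rewrite cabs_circle ?(ltW r0)// in D0; have {}D0 := D0 (lexx r).
have r2 : (r ^+ 2)%:C = r%:C * r%:C :> C by rewrite expr2 rmorphM.
rewrite r2 in D0 *.
move: rC E0 D0; move: (r%:C) (expi t) (conjc a) => x e b x0 e0 D0.
have D1 : x - b * e != 0.
  by apply/negP => /eqP D1; move: D0; rewrite mulrCA -mulrBr D1 mulr0 eqxx.
by field; apply/and3P; split=> //; rewrite mulNr.
Qed.

Lemma cauchy_circle (r : R) (a z : C) (f : C -> C) : cabs a < r ->
  (forall w, cabs (w - z) <= r -> derivable f w 1) ->
  cint 0 (2 * pi) (fun t => f (z + r%:C * expi t) * circle_kernel r a t) =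
  f (z + a) * (2 * pi)%:C.
Proof. by move=> ar df; rewrite cauchy_circle_ratio// cint_circle_kernel. Qed.

End Circle.

(** * Cauchy estimates *)

Section CauchyIntegral.
Variable R : realType.
Local Notation C := (R[i]^o).

(** [K] depends on [m] and [B] only, so the quadratic remainder is uniform along a circle and may be
    integrated; this replaces a theorem on differentiation under the integral sign. *)
Lemma expV_taylor2 (m : nat) (B : R) : 0 <= B ->
  exists2 K : R, 0 <= K & forall w h : C, w != 0 -> w - h != 0 ->
    cabs w^-1 <= B -> cabs (w - h)^-1 <= B ->
    cabs ((w - h)^-1 ^+ m - w^-1 ^+ m - m%:R * w^-1 ^+ m.+1 * h) <= K * cabs h ^+ 2.
Proof.
move=> B0; elim: m => [|m [K K0 IH]].
  exists 0 => // w h _ _ _ _.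
  by rewrite !expr0 subrr sub0r !mul0r cabsN cabs0.
exists (B * K + m.+1%:R * (B ^+ m.+2 * B)).
  by apply: addr_ge0; [exact: mulr_ge0|rewrite mulr_ge0// mulr_ge0// exprn_ge0].
move=> w h w0 wh0 wB whB; have {}IH := IH w h w0 wh0 wB whB.
have -> : (w - h)^-1 ^+ m.+1 - w^-1 ^+ m.+1 - m.+1%:R * w^-1 ^+ m.+2 * h =
    (w - h)^-1 * ((w - h)^-1 ^+ m - w^-1 ^+ m - m%:R * w^-1 ^+ m.+1 * h) +
    m.+1%:R * (w^-1 ^+ m.+2 * (w - h)^-1) * h ^+ 2.
  rewrite !exprSr -natr1; move: (_ ^+ m) (w^-1 ^+ m) (m%:R) => V U k.
  by field; apply/andP; split.
apply: (le_trans (cabsD _ _)); rewrite mulrDl lerD//.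
  by rewrite cabsM -(mulrA B) ler_pM ?cabs_ge0.
rewrite (cabsM _ (h ^+ 2)) (cabsX h) ler_wpM2r ?sqr_ge0//.
rewrite (cabsM m.+1%:R) (cabsM (w^-1 ^+ _)) cabsX.
have -> : cabs (m.+1%:R : C) = m.+1%:R.
  by rewrite -(rmorph_nat (real_complex R)) cabs_real ger0_norm.
rewrite ler_wpM2l// ler_pM//; [exact/exprn_ge0/cabs_ge0|exact: cabs_ge0|].
by rewrite lerXn2r// nnegrE cabs_ge0.
Qed.

Let pi2_ge0 : 0 <= 2 * pi :> R.
Proof. by rewrite mulr_ge0// pi_ge0. Qed.

Section Derivative.
Variables (r : R) (phi : R -> C).
Hypothesis cphi : {in `[0, 2 * pi], continuous phi}.

Definition cauchy_integral (m : nat) (a : C) : C :=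
  cint 0 (2 * pi) (fun t => phi t * (r%:C * expi t - a)^-1 ^+ m).

Lemma continuous_cauchy_integrand (m : nat) (a : C) : cabs a < r ->
  {in `[0, 2 * pi],
    continuous (fun t => phi t * (r%:C * expi t - a)^-1 ^+ m : C)}.
Proof.
move=> ar t tI; apply: (continuousCM (cphi tI)).
have c1 : {for t, continuous (fun t => (r%:C * expi t - a)^-1 : C)}.
  apply: (continuousCV (F := fun t => r%:C * expi t - a)); last exact: circle_neq.
  exact: (continuousCB (@continuous_circle R r t) (@continuousC_cst R R t a)).
elim: m => [|m IH]; first exact: (@continuousC_cst R R t 1).
rewrite (_ : (fun t => _) =
  fun t => (r%:C * expi t - a)^-1 * (r%:C * expi t - a)^-1 ^+ m).
  exact: (continuousCM c1 IH).
by apply/funext => s; rewrite exprS.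
Qed.

Lemma is_derive_cauchy_integral (m : nat) (a : C) : cabs a < r ->
  is_derive a 1 (cauchy_integral m) (m%:R * cauchy_integral m.+1 a).
Proof.
move=> ar; apply/is_derive_cabsP => e e0.
(* Half the distance from [a] to the circle: for [cabs h < d] both [a] and [a + h] keep distance at
   least [d] from it. *)
pose d := (r - cabs a) / 2.
have d0 : 0 < d by rewrite divr_gt0// subr_gt0.
have [M M1 phiM] := continuous_itv_cabs_bounded pi2_ge0 cphi.
have [K K0 KP] := @expV_taylor2 m d^-1 (ltW (etrans (invr_gt0 d) d0)).
pose A := 2 * (M * K * (2 * pi)).
have A0 : 0 <= A by rewrite !mulr_ge0//; [lra|exact: pi_ge0].
have A1 : 0 < A + 1 by lra.
(* The remainder is at most [A * cabs h ^+ 2]; [A + 1] covers [A = 0]. *)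
exists (Num.min d (e / (A + 1))); first by rewrite lt_min d0 divr_gt0.
move=> h; rewrite lt_min => /andP[hd he].
have ahr : cabs (a + h) < r.
  by apply: (le_lt_trans (cabsD _ _)); move: hd; rewrite /d; lra.
have c1 := continuous_cauchy_integrand (m := m) ar.
have c2 := continuous_cauchy_integrand (m := m) ahr.
have c3 := continuous_cauchy_integrand (m := m.+1) ar.
have c12 : {in `[0, 2 * pi], continuous (fun t =>
    phi t * (r%:C * expi t - (a + h))^-1 ^+ m - phi t * (r%:C * expi t - a)^-1 ^+ m : C)}.
  by move=> t tI; exact: (continuousCB (c2 t tI) (c1 t tI)).
have c4 : {in `[0, 2 * pi], continuous (fun t =>
    m%:R * h * (phi t * (r%:C * expi t - a)^-1 ^+ m.+1) : C)}.
  by move=> t tI; exact: (continuousCM (@continuousC_cst R R t (m%:R * h)) (c3 t tI)).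
have c5 : {in `[0, 2 * pi], continuous (fun t =>
    phi t * (r%:C * expi t - (a + h))^-1 ^+ m - phi t * (r%:C * expi t - a)^-1 ^+ m -
    m%:R * h * (phi t * (r%:C * expi t - a)^-1 ^+ m.+1) : C)}.
  by move=> t tI; exact: (continuousCB (c12 t tI) (c4 t tI)).
rewrite /cauchy_integral mulrAC -(cintZ _ c3) -(cintB c2 c1) -(cintB c12 c4).
apply: le_trans (cabs_cint_bound (M := M * K * cabs h ^+ 2) pi2_ge0 c5 _) _.
  move=> t tI.
  have -> : phi t * (r%:C * expi t - (a + h))^-1 ^+ m -
      phi t * (r%:C * expi t - a)^-1 ^+ m -
      m%:R * h * (phi t * (r%:C * expi t - a)^-1 ^+ m.+1) =
    phi t * ((r%:C * expi t - a - h)^-1 ^+ m - (r%:C * expi t - a)^-1 ^+ m -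
      m%:R * (r%:C * expi t - a)^-1 ^+ m.+1 * h).
    by rewrite opprD addrA; ring.
  have rt : cabs (r%:C * expi t) = r.
    by rewrite cabs_circle//; apply: ltW; exact: le_lt_trans (cabs_ge0 _) ar.
  rewrite cabsM -(mulrA M) ler_pM ?cabs_ge0 ?phiM//; apply: KP.
  - exact: circle_neq.
  - by rewrite -addrA -opprD; exact: circle_neq.
  - rewrite cabsV lef_pV2 ?posrE//; last by rewrite cabs_gt0; exact: circle_neq.
    apply: le_trans (cabsB_ge _ _); rewrite rt /d; lra.
  - rewrite -addrA -opprD cabsV lef_pV2 ?posrE//; last first.
      by rewrite cabs_gt0; exact: circle_neq.
    apply: le_trans (cabsB_ge _ _); rewrite rt.
    by have := cabsD a h; move: hd; rewrite /d; lra.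
rewrite subr0.
have -> : 2 * (M * K * cabs h ^+ 2 * (2 * pi)) = A * cabs h * cabs h.
  by rewrite /A; ring.
rewrite ler_wpM2r ?cabs_ge0//.
apply: (@le_trans _ _ (A * (e / (A + 1)))); first by rewrite ler_wpM2l// ltW.
by rewrite mulrA ler_pdivrMr// mulrC ler_wpM2l ?lerDl// ltW.
Qed.

End Derivative.

(** The formula is needed at every [a] of the open disc, because the induction differentiates it.
    The extra factor [r%:C * expi t] in the density comes from [dzeta = i zeta dt]. *)
Lemma derive1n_cauchy (f : C -> C) (r : R) (n : nat) :
  (forall w, cabs w <= r -> derivable f w 1) ->
  forall a : C, cabs a < r ->
  derive1n n f a = n`!%:R * ((2 * pi)%:C)^-1 *
    cauchy_integral r (fun t => f (r%:C * expi t) * (r%:C * expi t)) n.+1 a.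
Proof.
move=> df; set phi := fun t => _.
have [r0|r0] := ltP 0 r; last first.
  by move=> a /lt_le_trans/(_ r0); rewrite ltNge cabs_ge0.
have cphi : {in `[0, 2 * pi], continuous phi}.
  move=> t _.
  have cf : {for r%:C * expi t, continuous f}.
    by apply: derivable_continuousC; apply: df; rewrite cabs_circle// ltW.
  have cc := @continuous_circle R r t.
  exact: (continuousCM (continuous_comp cc cf) cc).
have pi0 : (2 * pi)%:C != 0 :> C.
  by rewrite -cabs_gt0 cabs_real normr_gt0 mulf_neq0// gt_eqF// pi_gt0.
elim: n => [|n IH] a ar.
  rewrite derive1n0 fact0 mul1r; apply: (mulfI pi0); rewrite mulVKf//.
  have df' w : cabs (w - 0) <= r -> derivable f w 1 by rewrite subr0; exact: df.
  have := cauchy_circle ar df'; rewrite add0r (mulrC (f a)) => <-.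
  by apply: eq_cint => t _; rewrite add0r /phi /circle_kernel expr1 mulrA.
rewrite derive1nS derive1E.
have near_f : \forall b \near a, ((n`!%:R * ((2 * pi)%:C)^-1) \*: cauchy_integral r phi n.+1) b =
    derive1n n f b.
  apply/nbhs_cabsP; exists (r - cabs a); first by rewrite subr_gt0.
  move=> w wa; rewrite IH ?mulrA//.
  by have := cabsD (w - a) a; rewrite subrK; move: wa; lra.
have D := is_derive_cauchy_integral cphi n.+1 ar.
have D' := @is_deriveZ _ _ _ _ (n`!%:R * ((2 * pi)%:C)^-1) _ _ _ D.
have [_ ->] := near_eq_is_derive near_f D'.
by rewrite factS natrM /GRing.scale /=; ring.
Qed.

(** The usual constant [1 / (2 pi r ^ n)] is doubled by [cabs_cint]. *)
Lemma cauchy_coefficient_bound (f : C -> C) (r : R) (n : nat) : 0 < r ->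
  (forall w, cabs w <= r -> derivable f w 1) ->
  cabs (derive1n n f 0) / n`!%:R <= (pi * r ^+ n)^-1 *
    \int[@lebesgue_measure R]_(t in `[0, 2 * pi]) cabs (f (r%:C * expi t)).
Proof.
move=> r0 df; have z_r : cabs (0 : C) < r by rewrite cabs0.
have cf : {in `[0, 2 * pi], continuous (fun t => f (r%:C * expi t))}.
  move=> t _.
  have cf : {for r%:C * expi t, continuous f}.
    by apply: derivable_continuousC; apply: df; rewrite cabs_circle// ltW.
  exact: (continuous_comp (@continuous_circle R r t) cf).
have cphi : {in `[0, 2 * pi], continuous (fun t => f (r%:C * expi t) * (r%:C * expi t) : C)}.
  by move=> t tI; exact: (continuousCM (cf t tI) (@continuous_circle R r t)).
rewrite (derive1n_cauchy _ df z_r) (cabsM (_ * _)) (cabsM n`!%:R).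
have -> : cabs (n`!%:R : C) = n`!%:R.
  by rewrite -(rmorph_nat (real_complex R)) cabs_real ger0_norm.
have nf0 : n`!%:R != 0 :> R by rewrite pnatr_eq0 -lt0n fact_gt0.
rewrite -(mulrA n`!%:R) [leLHS]mulrC mulKf// cabsV cabs_real ger0_norm//.
apply: (@le_trans _ _ ((2 * pi)^-1 * (2 * ((r ^+ n)^-1 *
    \int[@lebesgue_measure R]_(t in `[0, 2 * pi]) cabs (f (r%:C * expi t)))))); last first.
  rewrite le_eqVlt; apply/orP; left; apply/eqP.
  have E (x y I : R) : x != 0 -> y != 0 ->
      (2 * x)^-1 * (2 * (y^-1 * I)) = (x * y)^-1 * I.
    by move=> x0 y0; field; apply/andP; split.
  by apply: E; rewrite gt_eqF ?pi_gt0 ?exprn_gt0.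
rewrite ler_wpM2l ?invr_ge0//.
apply: le_trans (cabs_cint (continuous_cauchy_integrand cphi (m := n.+1) z_r)) _.
rewrite (ler_wpM2l (ler0n R 2))// -(RintegralZl _ _ (integrable_cabs cf))//.
rewrite le_eqVlt; apply/orP; left; apply/eqP.
apply: eq_Rintegral => t _.
rewrite subr0 (cabsM (_ * _)) (cabsM (f _)) cabsX cabsV cabs_circle ?(ltW r0)//.
rewrite exprVn exprS.
have E (x y I : R) : x != 0 -> y != 0 -> I * x * (x * y)^-1 = y^-1 * I.
  by move=> x0 y0; field; apply/andP; split.
by apply: E; rewrite gt_eqF ?exprn_gt0.
Qed.

End CauchyIntegral.

(** * Harnack inequality and means over squares *)

Section Harnack.
Variable R : realType.
Local Notation C := (R[i]^o).

(** The squares of the two moduli differ by [4 Re x Re y]. *)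
Lemma cabs_cayley_le (x y : C) : 0 <= complex.Re x -> 0 <= complex.Re y ->
  cabs (x - y) <= cabs (x + conjc y).
Proof.
case: x y => [a b] [c d] /= a0 c0.
rewrite -(@ler_pXn2r _ 2)// ?nnegrE ?cabs_ge0// !cabs_sqr /=.
rewrite lerD2r -subr_ge0 (_ : _ - _ = 4 * (a * c)); last by ring.
by rewrite mulr_ge0// mulr_ge0.
Qed.

Lemma harnack_cabs (g : C -> C) (z a : C) (r : R) : 0 < r ->
  (forall w, cabs (w - z) <= r -> derivable g w 1) ->
  (forall w, cabs (w - z) <= r -> 0 < complex.Re (g w)) ->
  cabs a <= r / 5 -> cabs (g z) <= 3 * cabs (g (z + a)).
Proof.
move=> r0 dg gpos ar5.
have ar : cabs a < r by apply: (le_lt_trans ar5); lra.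
have zr : cabs (z - z) <= r by rewrite subrr cabs0 ltW.
have zar : cabs (z + a - z) <= r by rewrite addrC addKr ltW.
have den w : cabs (w - z) <= r -> g w + conjc (g z) != 0.
  move=> wr; apply/negP => /eqP/(congr1 (@complex.Re R)).
  rewrite complexReD /= => h; have := gpos _ wr; have := gpos _ zr.
  by case: (g z) h => ? ? /= h; lra.
pose phi (w : C) : C := (g w - g z) * (g w + conjc (g z))^-1.
have dphi w : cabs (w - z) <= r -> derivable phi w 1.
  move=> wr; apply: derivableM.
    by apply: derivableB; [exact: dg|exact: derivable_cst].
  apply: derivableV; first exact: den.
  by apply: derivableD; [exact: dg|exact: derivable_cst].
have phi1 w : cabs (w - z) <= r -> cabs (phi w) <= 1.
  move=> wr; rewrite cabsM cabsV ler_pdivrMr ?cabs_gt0 ?den// mul1r.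
  by apply: cabs_cayley_le; apply: ltW; exact: gpos.
have zz : cabs (0 : C) < r by rewrite cabs0.
have Ea := cauchy_circle ar dphi; have E0 := cauchy_circle zz dphi.
have zt t : cabs (z + r%:C * expi t - z) <= r.
  by rewrite addrC addKr cabs_circle ?(ltW r0).
have cphi (t : R) : {for t, continuous (fun t => phi (z + r%:C * expi t))}.
  have cp : {for z + r%:C * expi t, continuous phi}.
    by apply: derivable_continuousC; apply: dphi.
  have cz := continuousCD (@continuousC_cst R R t z) (@continuous_circle R r t).
  exact: (continuous_comp cz cp).
have ck (b : C) : cabs b < r -> {in `[0, 2 * pi],
    continuous (fun t => phi (z + r%:C * expi t) * circle_kernel r b t : C)}.
  move=> br t _.
  exact: (continuousCM (@cphi t) (continuous_circle_kernel br (t := t))).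
have cka : {in `[0, 2 * pi], continuous (fun t =>
    phi (z + r%:C * expi t) * circle_kernel r a t -
    phi (z + r%:C * expi t) * circle_kernel r 0 t : C)}.
  by move=> t tI; exact: (continuousCB (ck a ar t tI) (ck 0 zz t tI)).
have pi2 : 0 < 2 * pi :> R by rewrite mulr_gt0// pi_gt0.
(* Since [phi z = 0], the kernel of [a] may be replaced by its difference with the kernel of 0, of
   modulus at most [cabs a / (r - cabs a)]. The radius [r / 5] makes this [1 / 4], and the factor 2
   of [cabs_cint_bound] gives [1 / 2]. *)
have phia : cabs (phi (z + a)) <= 2^-1.
  rewrite -(ler_pM2r pi2) -{1}(gtr0_norm pi2) -cabs_real -cabsM -Ea.
  have -> : cint 0 (2 * pi) (fun t => phi (z + r%:C * expi t) * circle_kernel r a t) =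
    cint 0 (2 * pi) (fun t => phi (z + r%:C * expi t) * circle_kernel r a t) -
    cint 0 (2 * pi) (fun t => phi (z + r%:C * expi t) * circle_kernel r 0 t).
    by rewrite E0 addr0 /phi subrr !mul0r subr0.
  rewrite -(cintB (ck a ar) (ck 0 zz)).
  apply: le_trans (cabs_cint_bound (M := 4^-1) (ltW pi2) cka _) _; last lra.
  move=> t _; rewrite -mulrBr cabsM.
  have na : r%:C * expi t - a != 0 by exact: circle_neq.
  have n0 : r%:C * expi t != 0.
    by rewrite -(subr0 (r%:C * expi t)); exact: circle_neq.
  have -> : circle_kernel r a t - circle_kernel r 0 t = a / (r%:C * expi t - a).
    rewrite /circle_kernel subr0; move: (r%:C * expi t) na n0 => x na n0.
    by field; apply/andP; split.
  rewrite -[4^-1]mul1r ler_pM ?cabs_ge0 ?phi1//.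
  rewrite cabsM cabsV ler_pdivrMr ?cabs_gt0//.
  have := cabsB_ge (r%:C * expi t) a; rewrite cabs_circle ?(ltW r0)//; lra.
move: phia; rewrite /phi cabsM cabsV ler_pdivrMr ?cabs_gt0 ?den// => h.
have h1 := cabsD (g (z + a)) (conjc (g z)); rewrite cabs_conj in h1.
have h2 := cabsB_ge (g z) (g (z + a)); rewrite cabsBC in h2.
lra.
Qed.

End Harnack.

(** * Bounding a value at the centre by a mean over the boundary of a square *)

Section Square.
Variable R : realType.
Local Notation C := (R[i]^o).
Local Notation mu := (@lebesgue_measure R).

(** [radial_cauchy] on the side [t +i* u] gives [4 f z] times the integral of [q] on one side, and
    the integral of [H (c u) * q u] on the other. There [cabs (q u) <= t^-1], and [cabs_cint] adds a
    factor 2. *)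
Lemma square_mean_bound (f : C -> C) (z : C) (t : R) : 0 < t ->
  (forall w, cabs (w - z) <= 2 * t -> derivable f w 1) ->
  2 * t * cabs (f z) <= \int[mu]_(u in `[- t, t])
    (cabs (f (z + 1 * (t +i* u))) + cabs (f (z + 'i * (t +i* u))) +
     cabs (f (z + (-1) * (t +i* u))) + cabs (f (z + (- 'i) * (t +i* u)))).
Proof.
move=> t0 df; have Ntt : - t <= t by lra.
pose c (u : R) : C := t +i* u.
pose q (u : R) : C := 'i * (c u)^-1.
(* H is invariant under w |-> i w, so the rays through the two endpoints of one side
   of the square contribute the same integrals. *)
pose H (w : C) : C := f (z + 1 * w) + f (z + 'i * w) + f (z + (-1) * w) + f (z + (- 'i) * w).
have cE u : c u = t%:C + 'i * u%:C by exact: complexE.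
have c_neq0 u : c u != 0.
  by apply/negP => /eqP/(congr1 (@complex.Re R)) /= h; lra.
have cc (u : R) : {for u, continuous c}.
  rewrite (_ : c = fun u => t%:C + 'i * u%:C); last by apply/funext => v; exact: cE.
  apply: (@continuousCD R R (fun=> t%:C) (fun u => 'i * u%:C)).
    exact: continuousC_cst.
  exact: (continuousCM (@continuousC_cst R R u 'i) (@continuous_real_complex R u)).
have cq (u : R) : {for u, continuous q}.
  exact: (continuousCM (@continuousC_cst R R u 'i) (continuousCV (@cc u) (c_neq0 u))).
have c_FTC (x y : R) : - t <= x -> x <= y -> y <= t ->
    cint x y (fun s => q s * c s) = c y - c x.
  move=> _ xy _.
  have dR (u : R) : is_derive u 1 (fun u => complex.Re (c u)) (complex.Re ('i : C)).
    exact: is_derive_cst.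
  have dI (u : R) : is_derive u 1 (fun u => complex.Im (c u)) (complex.Im ('i : C)).
    exact: is_derive_id.
  have ci : {in `[x, y], continuous (fun _ : R => 'i : C)}.
    by move=> u _; exact: continuousC_cst.
  rewrite -(cint_FTC xy ci dR dI); apply: eq_cint => u _.
  by rewrite /q -mulrA mulVf// mulr1.
have c_bound u : u \in `[- t, t] -> cabs (c u) <= 2 * t.
  rewrite in_itv/= => /andP[? ?]; apply: (le_trans (cabs_le_ReIm _)) => /=.
  by rewrite (gtr0_norm t0) mulr_natl mulr2n lerD2l ler_norml; apply/andP.
have rot (e : C) (s u : R) : cabs e = 1 -> 0 <= s <= 1 -> u \in `[- t, t] ->
    derivable (fun w : C => f (z + e * w)) (s%:C * c u) 1.
  move=> e1 /andP[s0 s1] uI; apply: derivable_affine_comp; apply: df.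
  rewrite addrC addKr cabsM e1 mul1r cabsM cabs_real (ger0_norm s0).
  have := c_bound u uI => h; apply: le_trans h.
  by rewrite ler_piMl ?cabs_ge0.
have e1 : cabs (1 : C) = 1 by exact: cabs1.
have ei : cabs ('i : C) = 1 by exact: cabs_i.
have eN1 : cabs (-1 : C) = 1 by rewrite cabsN.
have eNi : cabs (- 'i : C) = 1 by rewrite cabsN.
have dH (s u : R) : 0 <= s <= 1 -> u \in `[- t, t] -> derivable H (s%:C * c u) 1.
  move=> s01 uI; apply: derivableD; last exact: rot.
  apply: derivableD; last exact: rot.
  by apply: derivableD; exact: rot.
have H_closed (s : R) : 0 <= s <= 1 -> H (s%:C * c (- t)) = H (s%:C * c t).
  move=> _; have -> : c t = 'i * c (- t).
    by apply/eqP; rewrite eq_complex /= !mul0r !mul1r sub0r opprK add0r !eqxx.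
  rewrite /H; set w := s%:C * _; have -> : s%:C * ('i * c (- t)) = 'i * w.
    by rewrite /w mulrCA.
  have r1 : 1 * ('i * w) = 'i * w by rewrite mul1r.
  have r2 : 'i * ('i * w) = (-1) * w by rewrite mulrA -expr2 sqr_i.
  have r3 : (-1) * ('i * w) = (- 'i) * w by rewrite mulrA mulN1r.
  have r4 : (- 'i) * ('i * w) = 1 * w by rewrite mulrA mulNr -expr2 sqr_i opprK.
  rewrite r1 r2 r3 r4.
  by rewrite [RHS]addrC !addrA.
have cHc (u : R) : u \in `[- t, t] -> {for u, continuous (fun u => H (c u))}.
  move=> uI; have cH : {for c u, continuous H}.
    by apply: derivable_continuousC; have := dH 1 u; rewrite mul1r; apply=> //; rewrite ler01 lexx.
  exact: (continuous_comp (@cc u) cH).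
have := radial_cauchy Ntt (fun u _ => @cc u) (fun u _ => @cq u) c_FTC dH H_closed.
have -> : H 0 = 4 * f z by rewrite /H !mulr0 !addr0; ring.
move=> /(congr1 (@cabs R)); rewrite (cabsM (4 * f z)) (cabsM 4).
have -> : cabs (4 : C) = 4.
  by rewrite -(rmorph_nat (real_complex R)) cabs_real ger0_norm.
have cqI : {in `[- t, t], continuous q} by move=> u _; exact: cq.
(* The exact value of the integral is [i pi / 2]; the bound
   [Im q = t / (t ^ 2 + u ^ 2) >= 1 / (2 t)] suffices and avoids the arctangent. *)
have q1 : 1 <= cabs (cint (- t) t q).
  apply: le_trans (cabs_ge_Im _); apply: le_trans (ler_norm _).
  have I1 : \int[mu]_(u in `[- t, t]) (2 * t)^-1 = 1.
    by rewrite Rintegral_itv_cst//; field; rewrite gt_eqF.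
  rewrite -[leLHS]I1.
  apply: le_Rintegral => //; first by apply: continuous_itv_integrable => ? _; exact: cvg_cst.
    exact: (integrable_Im cqI).
  move=> u uI; have /andP[? ?] : - t <= u <= t by move: uI; rewrite /= in_itv.
  rewrite /q complexImM /= mul0r add0r mul1r.
  have tu : 0 < t ^+ 2 + u ^+ 2 by rewrite ltr_pwDl ?exprn_gt0 ?sqr_ge0.
  rewrite ler_pdivlMr// mulrC ler_pdivrMr ?mulr_gt0//.
  have : u ^+ 2 <= t ^+ 2.
    by rewrite -(real_normK (num_real u)) ler_pXn2r ?nnegrE ?(ltW t0)// ler_norml; apply/andP.
  rewrite !expr2; lra.
have cHq : {in `[- t, t], continuous (fun u => H (c u) * q u : C)}.
  by move=> u uI; exact: (continuousCM (@cHc u uI) (@cq u)).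
have h := cabs_cint cHq; move=> E; rewrite E in h.
pose S (u : R) := cabs (f (z + 1 * c u)) + cabs (f (z + 'i * c u)) +
     cabs (f (z + (-1) * c u)) + cabs (f (z + (- 'i) * c u)).
have crot (e : C) (u : R) : cabs e = 1 -> u \in `[- t, t] ->
    {for u, continuous (fun u => cabs (f (z + e * c u)))}.
  move=> e1' uI; apply: continuous_cabs_comp.
  have c1 : {for c u, continuous (fun w : C => f (z + e * w))}.
    apply: derivable_continuousC; have := rot e 1 u e1'; rewrite mul1r; apply=> //.
    by rewrite ler01 lexx.
  exact: (continuous_comp (@cc u) c1).
have cS : {in `[- t, t], continuous S}.
  move=> u uI; apply: cvgD; last exact: crot.
  apply: cvgD; last exact: crot.
  by apply: cvgD; exact: crot.
have iS := continuous_itv_integrable cS.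
have : \int[mu]_(u in `[- t, t]) cabs (H (c u) * q u) <=
    \int[mu]_(u in `[- t, t]) (t^-1 * S u).
  apply: le_Rintegral => //; first exact: (integrable_cabs cHq).
    exact: (integrableZl _ _ iS).
  move=> u _; rewrite cabsM mulrC ler_pM ?cabs_ge0//.
    rewrite /q cabsM cabs_i mul1r cabsV lef_pV2 ?posrE ?cabs_gt0//.
    by apply: le_trans (cabs_ge_Re _); rewrite /= ler_norm.
  apply: (le_trans (cabsD _ _)); rewrite lerD2r.
  apply: (le_trans (cabsD _ _)); rewrite lerD2r.
  exact: cabsD.
rewrite RintegralZl// -/(S _) => h2.
have h3 : 4 * cabs (f z) <= 4 * cabs (f z) * cabs (cint (- t) t q).
  by rewrite ler_peMr ?mulr_ge0 ?cabs_ge0.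
have h4 := le_trans h3 (le_trans h (ler_wpM2l (ler0n R 2) h2)).
have : t * (4 * cabs (f z)) <= t * (2 * (t^-1 * \int[mu]_(u in `[- t, t]) S u)).
  by rewrite ler_pM2l.
rewrite [in X in _ <= X]mulrCA mulVKf ?gt_eqF//; lra.
Qed.

End Square.

(** * Lebesgue measure on the plane *)

Section Translation.
Variable R : realType.
Local Notation mu := (@lebesgue_measure R).
Local Open Scope ereal_scope.

Definition translate (a : R) : measurableTypeR R -> measurableTypeR R :=
  fun x => (a + x)%R.

Lemma measurable_translate (a : R) : measurable_fun setT (translate a).
Proof. by apply: measurable_funD; [exact: measurable_cst|exact: measurable_id]. Qed.

HB.instance Definition _ (a : R) :=
  isMeasurableFun.Build _ _ _ _ (translate a) (measurable_translate a).

(** By uniqueness of Lebesgue measure it is enough to compare lengths of half-open intervals. *)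
Lemma lebesgue_measure_translate (a : R) (A : set R) : measurable A ->
  pushforward mu (translate a) A = mu A.
Proof.
move=> mA; apply/esym/lebesgue_measure_unique => //= _ [[x y]] _ <-.
rewrite /pushforward (_ : _ @^-1` _ = `](x - a)%R, (y - a)%R]%classic); last first.
  by apply/seteqP; split=> z; rewrite /translate /= !in_itv/= ltrBlDl lerBrDl.
rewrite !lebesgue_measure_itv/= !lte_fin ltrD2r; case: ifP => // _.
by rewrite -!EFinB; congr EFin; rewrite opprB addrA subrK.
Qed.

Lemma ge0_integral_translate (F : R -> \bar R) (a : R) :
  measurable_fun setT F -> (forall x, 0 <= F x) ->
  \int[mu]_x F (a + x)%R = \int[mu]_x F x.
Proof.
move=> mF F0; have := @ge0_integral_pushforward _ _ _ _ R _
  (measurable_translate a) mu setT F measurableT mF (fun y _ => F0 y).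
rewrite preimage_setT => <-.
by apply: eq_measure_integral => //= A mA _; exact: lebesgue_measure_translate.
Qed.

Lemma ge0_integral_reflect (F : R -> \bar R) (a : R) :
  measurable_fun setT F -> (forall x, 0 <= F x) ->
  \int[mu]_x F (a - x)%R = \int[mu]_x F x.
Proof.
move=> mF F0; rewrite -(ge0_integral_translate a mF F0).
have mG : measurable_fun setT (fun x => F (a + x)%R).
  exact: (measurableT_comp mF (measurable_translate a)).
have mN : measurable_fun setT (-%R : measurableTypeR R -> measurableTypeR R) by exact: oppr_measurable.
have := @ge0_integral_pushforward _ _ _ _ R _ mN mu setT _ measurableT mG (fun y _ => F0 _).
rewrite preimage_setT => <-.
by apply: eq_measure_integral => //= A mA _; exact: lebesgue_measureN.
Qed.

End Translation.

(** * Measurability of open subsets of the plane for the product sigma-algebra *)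

Section OpenPlane.
Variable R : realType.

(** An open set is the union of the half-open grid squares of mesh [1 / (n + 1)], over all [n], that
    it contains; there are countably many, each a product of intervals. *)
Lemma measurable_open_plane (U : set (R * R)) :
  (forall w, U w -> exists2 e : R, 0 < e &
    forall w', `|w'.1 - w.1| < e -> `|w'.2 - w.2| < e -> U w') ->
  measurable U.
Proof.
move=> oU.
pose cell (n : nat) (i : int) : set R := [set x | Num.floor (n.+1%:R * x) = i].
have mcell n i : measurable (cell n i).
  rewrite (_ : cell n i = `[(i%:~R / n.+1%:R), ((i + 1)%:~R / n.+1%:R)[%classic).
    exact: measurable_itv.
  apply/seteqP; split=> x; rewrite /cell /= in_itv/= ler_pdivrMr// ltr_pdivlMr// mulrC.
    by move=> <-; rewrite floor_le floorD1_gt.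
  by move=> h; apply: floor_def.
have cell_close n i x y : cell n i x -> cell n i y -> `|x - y| < n.+1%:R^-1.
  rewrite /cell /= => ex ey.
  have x1 := floor_le (n.+1%:R * x); have x2 := floorD1_gt (n.+1%:R * x).
  have y1 := floor_le (n.+1%:R * y); have y2 := floorD1_gt (n.+1%:R * y).
  rewrite ex in x1 x2; rewrite ey in y1 y2; rewrite intrD in x2 y2.
  rewrite -(ltr_pM2l (ltr0Sn R n)) mulfV// -{1}(gtr0_norm (ltr0Sn R n)) -normrM.
  by rewrite mulrBr ltr_norml; apply/andP; split; lra.
pose F (q : nat * (int * int)) : set (R * R) :=
  if pselect (cell q.1 q.2.1 `*` cell q.1 q.2.2 `<=` U)
  then cell q.1 q.2.1 `*` cell q.1 q.2.2 else set0.
have -> : U = \bigcup_q F q.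
  apply/seteqP; split=> [w Uw|w [q _]]; last first.
    by rewrite /F; case: pselect => // sub /sub.
  have [e e0 eU] := oU _ Uw.
  pose n := Num.truncn (e^-1).
  have ne : n.+1%:R^-1 <= e.
    by rewrite -[e]invrK lef_pV2 ?posrE ?invr_gt0// ltW// truncnS_gt.
  exists (n, (Num.floor (n.+1%:R * w.1), Num.floor (n.+1%:R * w.2))) => //.
  rewrite /F; case: pselect => //= -[] v [v1 v2]; apply: eU.
    by apply: lt_le_trans ne; exact: cell_close v1 _.
  by apply: lt_le_trans ne; exact: cell_close v2 _.
apply: countable_bigcupT_measurable => // q; rewrite /F; case: pselect => /= _ //.
exact: measurableX.
Qed.

End OpenPlane.

(** * Tonelli and the quarter turns around a point *)

Section PlaneIntegral.
Variable R : realType.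
Local Notation mu := (@lebesgue_measure R).
Local Notation plane := (measurableTypeR R * measurableTypeR R)%type.
Local Open Scope ereal_scope.

(** The boolean selects reflection or translation, so that one lemma serves each pair of opposite
    rotations. *)
Let act (b : bool) (a x : R) : R := if b then (a - x)%R else (a + x)%R.

Let measurable_act b a : measurable_fun setT (act b a : measurableTypeR R -> measurableTypeR R).
Proof.
case: b; last exact: measurable_translate.
by apply: measurable_funB; [exact: measurable_cst|exact: measurable_id].
Qed.

Let ge0_integral_act (F : R -> \bar R) b (a : R) :
  measurable_fun setT F -> (forall x, 0 <= F x) ->
  \int[mu]_x F (act b a x) = \int[mu]_x F x.
Proof.
by move=> mF F0; case: b; [exact: ge0_integral_reflect|exact: ge0_integral_translate].
Qed.

Variable Psi : plane -> \bar R.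
Hypotheses (mPsi : measurable_fun setT Psi) (Psi0 : forall w, 0 <= Psi w).

Let msection1 (x : R) : measurable_fun setT (fun y : measurableTypeR R => Psi (x, y)).
Proof. exact: measurable_fun_pair2. Qed.

Let msection2 (y : R) : measurable_fun setT (fun x : measurableTypeR R => Psi (x, y)).
Proof. exact: measurable_fun_pair1. Qed.

Let measurable_direct (b1 b2 : bool) (x0 y0 : R) :
  measurable_fun setT (fun w : plane => Psi (act b1 x0 w.1, act b2 y0 w.2)).
Proof.
apply: (measurableT_comp mPsi); apply: measurable_fun_pair.
  exact: (measurableT_comp (measurable_act b1 x0) measurable_fst).
exact: (measurableT_comp (measurable_act b2 y0) measurable_snd).
Qed.

Let measurable_swap (b1 b2 : bool) (x0 y0 : R) :
  measurable_fun setT (fun w : plane => Psi (act b1 x0 w.2, act b2 y0 w.1)).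
Proof.
apply: (measurableT_comp mPsi); apply: measurable_fun_pair.
  exact: (measurableT_comp (measurable_act b1 x0) measurable_snd).
exact: (measurableT_comp (measurable_act b2 y0) measurable_fst).
Qed.

Let integral_direct (b1 b2 : bool) (x0 y0 : R) :
  \int[(mu \x mu)]_w Psi (act b1 x0 w.1, act b2 y0 w.2) = \int[(mu \x mu)]_w Psi w.
Proof.
rewrite (fubini_tonelli1 _ (measurable_direct b1 b2 x0 y0) (fun _ => Psi0 _)).
rewrite (fubini_tonelli1 _ mPsi Psi0) /fubini_F /=.
rewrite -(@ge0_integral_act _ b1 x0 (measurable_fun_fubini_tonelli_F _ mPsi Psi0)); last first.
  by move=> x; apply: integral_ge0.
apply: eq_integral => t _.
exact: (ge0_integral_act b2 y0 (msection1 (act b1 x0 t)) (fun y => Psi0 _)).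
Qed.

(** A quarter turn exchanges the coordinates, so the two sides are unfolded by Tonelli in opposite
    orders. *)
Let integral_swap (b1 b2 : bool) (x0 y0 : R) :
  \int[(mu \x mu)]_w Psi (act b1 x0 w.2, act b2 y0 w.1) = \int[(mu \x mu)]_w Psi w.
Proof.
rewrite (fubini_tonelli1 _ (measurable_swap b1 b2 x0 y0) (fun _ => Psi0 _)).
rewrite (fubini_tonelli2 _ mPsi Psi0) /fubini_F /fubini_G /=.
rewrite -(@ge0_integral_act _ b2 y0 (measurable_fun_fubini_tonelli_G _ mPsi Psi0)); last first.
  by move=> x; apply: integral_ge0.
apply: eq_integral => t _.
exact: (ge0_integral_act b1 x0 (msection2 (act b2 y0 t)) (fun x => Psi0 _)).
Qed.

(* The four points are the images of (x0 + t, y0 + u) under the rotations of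
   order 4 around (x0, y0). *)
Definition four_fold (x0 y0 t u : R) : \bar R :=
  Psi (x0 + t, y0 + u)%R + Psi (x0 - u, y0 + t)%R +
  Psi (x0 - t, y0 - u)%R + Psi (x0 + u, y0 - t)%R.

Lemma four_fold_ge0 x0 y0 t u : 0 <= four_fold x0 y0 t u.
Proof. by rewrite !adde_ge0. Qed.

Let measurable_four_fold_plane x0 y0 :
  measurable_fun setT (fun w : plane => four_fold x0 y0 w.1 w.2).
Proof.
have m1 := measurable_direct false false x0 y0.
have m2 := measurable_swap true false x0 y0.
have m3 := measurable_direct true true x0 y0.
have m4 := measurable_swap false true x0 y0.
by apply: emeasurable_funD => //; apply: emeasurable_funD => //; exact: emeasurable_funD.
Qed.

Lemma measurable_four_fold x0 y0 t :
  measurable_fun setT (four_fold x0 y0 t : measurableTypeR R -> _).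
Proof. exact: (measurable_fun_pair2 t (measurable_four_fold_plane x0 y0)). Qed.

Let integral_four_fold x0 y0 :
  \int[(mu \x mu)]_w four_fold x0 y0 w.1 w.2 = 4%:E * \int[(mu \x mu)]_w Psi w.
Proof.
have m1 := measurable_direct false false x0 y0.
have m2 := measurable_swap true false x0 y0.
have m3 := measurable_direct true true x0 y0.
have m4 := measurable_swap false true x0 y0.
rewrite ge0_integralD//; first last.
- by apply: emeasurable_funD => //; exact: emeasurable_funD.
- by move=> w _; rewrite !adde_ge0.
rewrite ge0_integralD//; first last.
- exact: emeasurable_funD.
- by move=> w _; rewrite !adde_ge0.
rewrite ge0_integralD//.
have := integral_direct false false x0 y0; rewrite /act => ->.
have := integral_swap true false x0 y0; rewrite /act => ->.
have := integral_direct true true x0 y0; rewrite /act => ->.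
have := integral_swap false true x0 y0; rewrite /act => ->.
have : 0 <= \int[(mu \x mu)]_w Psi w by exact: integral_ge0.
move: (\int[_]_w Psi w) => I I0.
rewrite (_ : 4%:E = 1 + 1 + 1 + 1)%E; last by rewrite -!EFinD; congr EFin; ring.
by rewrite !ge0_muleDl ?mul1e// !adde_ge0.
Qed.

(** As [Psi] is nonnegative, the strip [d1 <= t <= d2] can be enlarged to the plane, where each of
    the four copies has the integral of [Psi]. Overlaps between the copies are harmless. *)
Lemma le_integral_four_fold (x0 y0 d1 d2 k : R) : (d1 <= d2)%R -> (0 <= k)%R ->
  (forall t, t \in `[d1, d2] -> k%:E <= \int[mu]_u four_fold x0 y0 t u) ->
  (k * (d2 - d1))%:E <= 4%:E * \int[(mu \x mu)]_w Psi w.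
Proof.
move=> d12 k0 kI; rewrite -(integral_four_fold x0 y0).
have mPhi := measurable_four_fold_plane x0 y0.
have Phi0 (w : plane) : 0 <= four_fold x0 y0 w.1 w.2 by exact: four_fold_ge0.
rewrite (fubini_tonelli1 _ mPhi Phi0).
have mF := measurable_fun_fubini_tonelli_F (m2 := mu) _ mPhi Phi0.
have F0 x : 0 <= fubini_F mu (fun w => four_fold x0 y0 w.1 w.2) x.
  by apply: integral_ge0.
apply: (@le_trans _ _ (\int[mu]_(t in `[d1, d2])
    fubini_F mu (fun w => four_fold x0 y0 w.1 w.2) t)); last first.
  exact: ge0_subset_integral.
have <- : \int[mu]_(t in `[d1, d2]) k%:E = (k * (d2 - d1))%:E.
  rewrite integral_cst//= lebesgue_measure_itv/= lte_fin EFinM.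
  case: ltP => // d21; have -> : d2 = d1 by apply/eqP; rewrite eq_le d21 d12.
  by rewrite subrr mule0.
by apply: ge0_le_integral => //; exact: (measurable_funTS mF).
Qed.

End PlaneIntegral.

(** * Bergman spaces *)

Section Bergman.
Variable R : realType.
Local Notation C := (R[i]^o).
Local Notation mu := (@lebesgue_measure R).
Local Notation plane := (measurableTypeR R * measurableTypeR R)%type.

Let pt (w : plane) : C := w.1 +i* w.2.

Definition disc_plane : set plane := [set w | disc (pt w)].

Let pt_close (w w' : plane) (e : R) : `|w'.1 - w.1| < e -> `|w'.2 - w.2| < e ->
  cabs (pt w' - pt w) < 2 * e.
Proof.
move=> h1 h2; apply: (le_lt_trans (cabs_le_ReIm _)).
by rewrite complexReD complexImD complexReN complexImN /= mulr_natl mulr2n ltrD.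
Qed.

Let disc_open (w : plane) : disc_plane w -> exists2 e : R, 0 < e &
  forall w' : plane, `|w'.1 - w.1| < e -> `|w'.2 - w.2| < e -> disc_plane w'.
Proof.
rewrite /disc_plane /disc /= => w1; exists ((1 - cabs (pt w)) / 2).
  by rewrite divr_gt0// subr_gt0.
move=> w' h1 h2; have := pt_close h1 h2.
have := cabsD (pt w' - pt w) (pt w); rewrite subrK.
set c := cabs (pt w) in w1 *; move: w1; lra.
Qed.

Lemma measurable_disc_plane : measurable disc_plane.
Proof. exact: measurable_open_plane. Qed.

Lemma measurable_cabs_analytic (F : C -> C) : analytic_on_disc F ->
  measurable_fun disc_plane (fun w => cabs (F (pt w)) : measurableTypeR R).
Proof.
move=> aF; apply: (measurability _ (RGenOInfty.measurableE R)).
move=> /= _ [_ [a ->]] <-; apply: measurable_open_plane => w [Dw].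
rewrite /= in_itv/= andbT => aw.
have cF : {for pt w, continuous (fun z => cabs (F z) : R)}.
  exact: continuous_comp (derivable_continuousC (aF _ Dw)) (@continuous_cabs R _).
have [d d0 dP] := disc_open Dw.
have e0 : 0 < cabs (F (pt w)) - a by rewrite subr_gt0.
have /(@cvgrPdist_lt R R^o C (nbhs (pt w)))/(_ _ e0)/nbhs_cabsP[r r0 rP] := cF.
exists (Num.min d (r / 2)); first by rewrite lt_min d0 divr_gt0.
move=> w'; rewrite !lt_min => /andP[h1 h1'] /andP[h2 h2'].
split; first exact: dP.
rewrite /= in_itv/= andbT.
have := pt_close h1' h2'; rewrite mulrC divfK ?gt_eqF// => /rP.
by rewrite ltr_norml => /andP[_]; rewrite ltrD2l ltrN2.
Qed.

Let powR_inv (x r : R) : 0 <= x -> x^-1 `^ r = (x `^ r)^-1.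
Proof. by move=> x0; rewrite -(powR_inv1 x0) powRAC powR_inv1 ?powR_ge0. Qed.

(** If [x <= l] the first term suffices; otherwise [x / l >= 1] is at most its [p]-th power. *)
Let young (x l p : R) : 0 <= x -> 0 < l -> 1 <= p -> x <= l + l / l `^ p * x `^ p.
Proof.
move=> x0 l0 p1; have [xl|lx] := leP x l.
  by apply: (le_trans xl); rewrite lerDl mulr_ge0 ?divr_ge0 ?powR_ge0 ?ltW.
have xl1 : 1 <= x / l by rewrite ler_pdivlMr// mul1r ltW.
have -> : l / l `^ p * x `^ p = l * (x / l) `^ p.
  by rewrite powRM ?invr_ge0 ?(ltW l0)// powR_inv ?(ltW l0)//; ring.
have h := le1r_powR xl1 p1.
have : x <= l * (x / l) `^ p.
  by apply: le_trans (ler_wpM2l (ltW l0) h); rewrite mulrC divfK ?gt_eqF.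
lra.
Qed.

Section Pointwise.
Variables (p : R) (g f : C -> C) (gamma : R) (z : R[i]).
Hypotheses (p1 : 1 <= p) (ag : analytic_on_disc g)
  (gpos : forall z, disc z -> 0 < complex.Re (g z)) (gamma01 : 0 < gamma < 1).
Let phi (z : R[i]) := cabs (g z) `^ gamma.
Hypotheses (bf : bergman phi p f) (Dz : disc z).

Let J := fine (bergman_integral phi p f).
(** Squares of half-side at most [rho] lie within [2 * rho] of [z], and this is one fifth of
    [(1 - cabs z) / 2], as [harnack_cabs] requires on the disc of that radius, which stays inside
    the unit disc. *)
Let rho := (1 - cabs z) / 20.
Let G := cabs (g z) `^ gamma.

Let rho0 : 0 < rho.
Proof. by rewrite divr_gt0// subr_gt0. Qed.

Let g_gt0 w : disc w -> 0 < cabs (g w).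
Proof.
move=> /gpos gw; apply: lt_le_trans (cabs_ge_Re _).
by apply: lt_le_trans gw _; rewrite ler_norm.
Qed.

Let G0 : 0 < G.
Proof. by rewrite powR_gt0// g_gt0. Qed.

Let weight (w : plane) : R := cabs (f (pt w)) `^ p * phi (pt w).

Let measurable_weight : measurable_fun disc_plane (weight : _ -> measurableTypeR R).
Proof.
apply: measurable_funM.
  by apply: (measurableT_comp (measurable_powR _)); exact: measurable_cabs_analytic (proj1 bf).
by apply: (measurableT_comp (measurable_powR _)); exact: measurable_cabs_analytic.
Qed.

Let weight_ge0 w : 0 <= weight w.
Proof. by rewrite mulr_ge0// powR_ge0. Qed.

Let near_z w : cabs (w - z) <= 2 * rho -> disc w.
Proof.
rewrite /disc /= /rho => h; have := cabsD (w - z) z; rewrite subrK.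
by have := Dz; rewrite /disc /=; set c := cabs z in h *; move: h; lra.
Qed.

(** [harnack_cabs] raised to the power [gamma]; since [gamma < 1], [3 ^ gamma] is replaced by 3 and
    the constant no longer depends on [gamma]. *)
Let phi_harnack w : cabs (w - z) <= 2 * rho -> G <= 3 * phi w.
Proof.
move=> wz; have [gm0 gm1] := andP gamma01.
have r0 : 0 < (1 - cabs z) / 2 by rewrite divr_gt0// subr_gt0.
have inD v : cabs (v - z) <= (1 - cabs z) / 2 -> disc v.
  rewrite /disc /= => h; have := cabsD (v - z) z; rewrite subrK.
  by have := Dz; rewrite /disc /=; move: h; lra.
have wz' : cabs (w - z) <= (1 - cabs z) / 2 / 5.
  by move: wz; rewrite /rho; lra.
have := harnack_cabs r0 (fun v vz => ag (inD v vz)) (fun v vz => gpos (inD v vz)) wz'.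
rewrite addrC subrK => h.
have := ge0_ler_powR (ltW gm0) _ _ h; rewrite !nnegrE => /(_ (cabs_ge0 _)).
rewrite mulr_ge0 ?cabs_ge0// => /(_ isT)/le_trans; apply.
rewrite powRM ?cabs_ge0// ler_wpM2r ?powR_ge0//.
by rewrite ler1_powR ?(ltW gm1)//; lra.
Qed.

Let J_ge0 : 0 <= J.
Proof.
by apply: fine_ge0; apply: integral_ge0 => w _; rewrite lee_fin weight_ge0.
Qed.

(** [pi] undoes the normalization of [dA]; membership in the Bergman space makes the integral
    finite, so [fine] loses nothing. *)
Let integral_weight :
  (\int[(mu \x mu)%E]_(w in disc_plane) (weight w)%:E = (pi * J)%:E)%E.
Proof.
have [_ finJ] := bf.
have E : bergman_integral phi p f =
    ((pi^-1)%:E * \int[(mu \x mu)%E]_(w in disc_plane) (weight w)%:E)%E.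
  rewrite /bergman_integral /dA ge0_integral_mscale//.
  - exact: measurable_disc_plane.
  - by apply/measurable_EFinP; exact: measurable_weight.
  - by move=> w _; rewrite lee_fin weight_ge0.
have JE : bergman_integral phi p f = J%:E.
  rewrite /J fineK// ge0_fin_numE//.
  by apply: integral_ge0 => w _; rewrite lee_fin weight_ge0.
rewrite EFinM -JE E muleA -EFinM divff ?mul1e// gt_eqF// pi_gt0//.
Qed.

(** On four sides of length [2 t] the summand [l] of [young] contributes [8 t l], whence [4 l] after
    division by [2 t]. Integration over [t] in an interval of length [rho / 2] gives [rho ^ 2 / 2]
    on the left and [4 A pi J] on the right, whence [8 A pi J / rho ^ 2]; the 3 in [A] comes from
    [phi_harnack], and [24 = 8 * 3]. *)
Let scaled_bound (l : R) : 0 < l ->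
  cabs (f z) <= l * (4 + 24 * pi * (J / (l `^ p * G * rho ^+ 2))).
Proof.
move=> l0; have lp0 : 0 < l `^ p by rewrite powR_gt0.
pose A := 3 * l / (l `^ p * G).
have A0 : 0 <= A by rewrite divr_ge0 ?mulr_ge0 ?ltW.
have goalE : l * (4 + 24 * pi * (J / (l `^ p * G * rho ^+ 2))) =
    4 * l + 8 * (A * (pi * J)) / rho ^+ 2.
  by rewrite /A; field; rewrite !gt_eqF.
(* In the remaining case [cabs (f z) - 4 * l] is positive, which allows [2 * t] to be lowered to
   [rho]. *)
have [fl|lf] := leP (cabs (f z)) (4 * l).
  rewrite goalE; apply: (le_trans fl); rewrite lerDl divr_ge0 ?sqr_ge0//.
  exact: mulr_ge0 (ler0n R 8) (mulr_ge0 A0 (mulr_ge0 (pi_ge0 R) J_ge0)).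
pose Psi : plane -> \bar R := (fun w => (A * weight w)%:E) \_ disc_plane.
have mPsi : measurable_fun setT Psi.
  apply/(measurable_restrictT _ measurable_disc_plane)/measurable_EFinP.
  by apply: measurable_funM; [exact: measurable_cst|exact: measurable_weight].
have Psi0 w : (0 <= Psi w)%E.
  by rewrite /Psi patchE; case: ifP => // _; rewrite lee_fin mulr_ge0.
have IPsi : (\int[(mu \x mu)%E]_w Psi w = (A * (pi * J))%:E)%E.
  rewrite /Psi -integral_mkcond EFinM -integral_weight -ge0_integralZl_EFin//.
  - exact: measurable_disc_plane.
  - by move=> w _; rewrite lee_fin weight_ge0.
  - by apply/measurable_EFinP; exact: measurable_weight.
(* Outside the disc [f] is arbitrary; extension by zero makes its modulus measurable on the
   plane. *)
pose Q : plane -> \bar R := (fun w => (cabs (f (pt w)))%:E) \_ disc_plane.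
have mQ : measurable_fun setT Q.
  apply/(measurable_restrictT _ measurable_disc_plane)/measurable_EFinP.
  exact: measurable_cabs_analytic (proj1 bf).
have Q0 w : (0 <= Q w)%E.
  by rewrite /Q patchE; case: ifP => // _; rewrite lee_fin cabs_ge0.
have QE (a b : R) : cabs ((a +i* b : C) - z) <= 2 * rho ->
    Q (a, b) = (cabs (f (a +i* b)))%:E.
  by move=> /near_z Dab; rewrite /Q patchE mem_set.
have Q_le (a b : R) : cabs ((a +i* b : C) - z) <= 2 * rho ->
    (Q (a, b) <= l%:E + Psi (a, b))%E.
  move=> ab; have Dab := near_z ab.
  rewrite QE// /Psi patchE mem_set// -EFinD lee_fin.
  apply: (le_trans (young (cabs_ge0 _) l0 p1)); rewrite lerD2l.
  have -> : A * weight (a, b) =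
      l / l `^ p * cabs (f (a +i* b)) `^ p * (3 * phi (a +i* b) / G).
    by rewrite /A /weight /pt /=; field; rewrite !gt_eqF.
  rewrite ler_peMr ?mulr_ge0 ?invr_ge0 ?powR_ge0 ?(ltW l0)//.
  by rewrite ler_pdivlMr// mul1r phi_harnack.
have k0 : 0 <= rho * (cabs (f z) - 4 * l) by rewrite mulr_ge0 ?ltW// subr_gt0.
have step (t : R) : t \in `[rho / 2, rho] ->
  ((rho * (cabs (f z) - 4 * l))%:E <=
    \int[mu]_u four_fold Psi (complex.Re z) (complex.Im z) t u)%E.
  rewrite in_itv/= => /andP[t1 t2].
  have t0 : 0 < t by have := rho0; lra.
  have df w : cabs (w - z) <= 2 * t -> derivable f w 1.
    by move=> wt; apply: (proj1 bf); apply: near_z; apply: (le_trans wt); lra.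
  set x0 := complex.Re z; set y0 := complex.Im z.
  have zE : z = x0 +i* y0 by rewrite /x0 /y0; case: (z).
  have e1 u : z + 1 * (t +i* u) = (x0 + t) +i* (y0 + u) by rewrite mul1r zE.
  have e2 u : z + 'i * (t +i* u) = (x0 - u) +i* (y0 + t).
    by apply/eqP; rewrite zE eq_complex /= !mul0r !mul1r sub0r add0r !eqxx.
  have e3 u : z + (-1) * (t +i* u) = (x0 - t) +i* (y0 - u) by rewrite mulN1r zE.
  have e4 u : z + (- 'i) * (t +i* u) = (x0 + u) +i* (y0 - t).
    apply/eqP; rewrite zE eq_complex /= oppr0 !mul0r !mulN1r opprK sub0r add0r.
    by rewrite ?oppr0 ?add0r ?addr0 !eqxx.
  have close (e : C) (u : R) : cabs e = 1 -> u \in `[- t, t] ->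
      cabs (z + e * (t +i* u) - z) <= 2 * rho.
    move=> ce; rewrite in_itv/= => /andP[u1 u2].
    rewrite addrC addKr cabsM ce mul1r; apply: (le_trans (cabs_le_ReIm _)) => /=.
    have : `|u| <= t by rewrite ler_norml u1.
    by rewrite (gtr0_norm t0); lra.
  have c1 u (uI : u \in `[- t, t]) := close 1 u (@cabs1 R) uI.
  have c2 u (uI : u \in `[- t, t]) := close 'i u (@cabs_i R) uI.
  have c3 u (uI : u \in `[- t, t]) := close (-1) u (etrans (cabsN 1) (@cabs1 R)) uI.
  have c4 u (uI : u \in `[- t, t]) := close (- 'i) u (etrans (cabsN 'i) (@cabs_i R)) uI.
  have I1 := square_mean_bound t0 df.
  have mQt := measurable_four_fold mQ x0 y0 t.
  have mPt := measurable_four_fold mPsi x0 y0 t.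
  have le1 : ((2 * t * cabs (f z))%:E <= \int[mu]_(u in `[(- t)%R, t]) four_fold Q x0 y0 t u)%E.
    move: I1; rewrite -lee_fin => /le_trans; apply.
    rewrite /Rintegral.
    have -> : (\int[mu]_(u in `[(- t)%R, t]) four_fold Q x0 y0 t u =
      \int[mu]_(u in `[(- t)%R, t]) (cabs (f (z + 1 * (t +i* u))) + cabs (f (z + 'i * (t +i* u))) +
        cabs (f (z + (-1) * (t +i* u))) + cabs (f (z + (- 'i) * (t +i* u))))%:E)%E.
      apply: eq_integral => u; rewrite inE/= => uI; rewrite /four_fold.
      rewrite !QE -?e1 -?e2 -?e3 -?e4 ?EFinD//; [exact: c4|exact: c3|exact: c2|exact: c1].
    (* A finite integral equals its [fine] part, and an infinite one makes the bound trivial; no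
       integrability has to be shown. *)
    case: (ltP (\int[mu]_(u in `[(- t)%R, t]) (cabs (f (z + 1 * (t +i* u))) + cabs (f (z + 'i * (t +i* u))) +
        cabs (f (z + (-1) * (t +i* u))) + cabs (f (z + (- 'i) * (t +i* u))))%:E)%E +oo%E) => [fin|].
      rewrite fineK// ge0_fin_numE//; apply: integral_ge0 => u _.
      by rewrite lee_fin !addr_ge0 ?cabs_ge0.
    by rewrite leye_eq => /eqP ->; rewrite leey.
  have le2 : (\int[mu]_(u in `[(- t)%R, t]) four_fold Q x0 y0 t u <=
      (8 * t * l)%:E + \int[mu]_u four_fold Psi x0 y0 t u)%E.
    apply: (@le_trans _ _ (\int[mu]_(u in `[(- t)%R, t]) ((4 * l)%:E + four_fold Psi x0 y0 t u))%E).
      apply: ge0_le_integral => //.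
      - by move=> u _; exact: four_fold_ge0.
      - exact: (measurable_funTS mQt).
      - by apply: emeasurable_funD; [exact: measurable_cst|exact: (measurable_funTS mPt)].
      - move=> u uI; rewrite /four_fold.
        have -> : (4 * l)%:E = (l%:E + l%:E + l%:E + l%:E)%E.
          by rewrite -!EFinD; congr EFin; ring.
        rewrite (addeACA _ l%:E) (addeACA _ l%:E) (addeACA l%:E).
        by rewrite !leeD// Q_le// -?e1 -?e2 -?e3 -?e4; [exact: c1|exact: c2|exact: c3|exact: c4].
    rewrite ge0_integralD//.
    - rewrite integral_cst//= lebesgue_measure_itv/= lte_fin ifT; last lra.
      rewrite -EFinB -EFinM leeD//.
        by rewrite lee_fin; lra.
      by apply: ge0_subset_integral => // u _; exact: four_fold_ge0.
    - by move=> u _; rewrite lee_fin mulr_ge0 ?ltW.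
    - by move=> u _; exact: four_fold_ge0.
    - exact: (measurable_funTS mPt).
  have le3 := le_trans le1 le2.
  rewrite -leeBlDl// -EFinB in le3; apply: le_trans le3; rewrite lee_fin.
  have -> : 2 * t * cabs (f z) - 8 * t * l = 2 * t * (cabs (f z) - 4 * l) by ring.
  by rewrite ler_wpM2r ?subr_ge0 ?(ltW lf)//; lra.
have r12 : rho / 2 <= rho by have := rho0; lra.
have := le_integral_four_fold mPsi Psi0 r12 k0 step.
rewrite IPsi -EFinM lee_fin goalE => h.
have r2 : 0 < rho ^+ 2 by rewrite exprn_gt0.
rewrite -lerBlDl ler_pdivlMr//.
by move: h; rewrite expr2; lra.
Qed.

(** [scaled_bound] with [l] just above [B] to the power [1 / p], for which [B / l ^ p <= 1]; the
    factor [20 ^ (2 / p)] comes from the denominator of [rho]. *)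
Lemma bergman_pointwise :
  cabs (f z) <= (4 + 24 * pi) * 20 `^ (2 / p) /
    ((1 - cabs z) `^ (2 / p) * cabs (g z) `^ (gamma / p)) * bergman_norm phi p f.
Proof.
have p0 : 0 < p := lt_le_trans ltr01 p1.
pose B := (J / (G * rho ^+ 2)).
have B0 : 0 <= B by rewrite divr_ge0// mulr_ge0 ?sqr_ge0 ?ltW.
pose K : R := 4 + 24 * pi.
have K0 : 0 < K by have := @pi_gt0 R; rewrite /K; lra.
have lim (e : R) : 0 < e -> cabs (f z) <= K * B `^ p^-1 + e.
  (* The summand [e / K] keeps [l] positive when [B = 0]. *)
  move=> e0; pose l := B `^ p^-1 + e / K.
  have eK0 : 0 < e / K by rewrite divr_gt0.
  have l0 : 0 < l by rewrite ltr_wpDl ?powR_ge0.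
  have lp0 : 0 < l `^ p by rewrite powR_gt0.
  apply: le_trans (scaled_bound l0) _.
  have -> : K * B `^ p^-1 + e = l * K.
    by rewrite /l [RHS]mulrDl divfK ?gt_eqF// (mulrC K).
  rewrite ler_pM2l// /K lerD2l ler_piMr ?mulr_ge0 ?pi_ge0//.
  have -> : J / (l `^ p * G * rho ^+ 2) = B / l `^ p.
    by rewrite /B; field; rewrite !gt_eqF ?rho0.
  rewrite ler_pdivrMr// mul1r.
  have {1}-> : B = (B `^ p^-1) `^ p by rewrite -powRrM mulVf ?gt_eqF// powRr1.
  apply: ge0_ler_powR; rewrite ?nnegrE ?powR_ge0 ?ltW// /l.
  by rewrite ltrDl.
have h : cabs (f z) <= K * B `^ p^-1 by apply/ler_addgt0Pr => e /lim.
apply: (le_trans h); rewrite -/K.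
have s0 : 0 < 1 - cabs z by rewrite subr_gt0.
have s0' := ltW s0.
have -> : B `^ p^-1 = bergman_norm phi p f * (cabs (g z) `^ (gamma / p) * ((1 - cabs z) `^ (2 / p) / 20 `^ (2 / p)))^-1.
  rewrite /B /bergman_norm -/J powRM ?invr_ge0 ?mulr_ge0 ?sqr_ge0 ?(ltW G0)//.
  congr (_ * _).
  rewrite powR_inv ?mulr_ge0 ?sqr_ge0 ?(ltW G0)//.
  congr (_^-1); rewrite powRM ?sqr_ge0 ?(ltW G0)// /G -powRrM; congr (_ * _).
  rewrite -powR_mulrn ?(ltW rho0)// -powRrM /rho powRM//; congr (_ * _).
  by rewrite powR_inv.
rewrite le_eqVlt /K; apply/orP; left; apply/eqP; field.
by rewrite !gt_eqF ?powR_gt0 ?g_gt0.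
Qed.

End Pointwise.
End Bergman.

Theorem proposition2p5 (R : realType) (p : R) (hp : 1 <= p) :
  (exists C : R, 0 < C /\
    forall (g : R[i]^o -> R[i]^o) (gamma : R),
      univalent g -> (forall z, disc z -> 0 < complex.Re (g z)) ->
      0 < gamma < 1 ->
      let phi := fun z : R[i] => cabs (g z) `^ gamma in
      forall f : R[i]^o -> R[i]^o, bergman phi p f ->
      forall z : R[i], disc z ->
        cabs (f z) <=
          C / ((1 - cabs z) `^ (2 / p) * cabs (g z) `^ (gamma / p))
            * bergman_norm phi p f)
  /\
  (exists C' : R, 0 < C' /\
    forall (g : R[i]^o -> R[i]^o) (gamma : R),
      univalent g -> (forall z, disc z -> 0 < complex.Re (g z)) ->
      0 < gamma < 1 ->
      let phi := fun z : R[i] => cabs (g z) `^ gamma in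
      forall (n : nat) (f : R[i]^o -> R[i]^o), bergman phi p f ->
      forall r : R, 0 < r < 1 ->
        cabs (derive1n n f 0) / n`!%:R <=
          C' * bergman_norm phi p f / (r ^+ n * (1 - r) `^ (2 / p))
            * \int[@lebesgue_measure R]_(theta in `[0, 2 * pi])
                (cabs (g (r%:C * (cos theta +i* sin theta)))
                   `^ (gamma / p))^-1).
Proof.
pose K : R := (4 + 24 * pi) * 20 `^ (2 / p).
have K0 : 0 < K.
  by rewrite mulr_gt0 ?powR_gt0// addr_gt0// mulr_gt0// pi_gt0.
split.
  exists K; split=> // g gamma [ag _] gpos gamma01 phi f bf z Dz.
  exact: bergman_pointwise.
(* [K] is the constant of the pointwise bound, and [1 / pi] is that of [cauchy_coefficient_bound];
   neither depends on [n]. *)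
exists (K / pi); split; first by rewrite divr_gt0// pi_gt0.
move=> g gamma [ag _] gpos gamma01 phi n f bf r /andP[r0 r1].
have circ_disc t : disc (r%:C * expi t) by rewrite /disc /= cabs_circle ?(ltW r0).
have df w : cabs w <= r -> derivable f w 1.
  by move=> wr; apply: (proj1 bf); exact: le_lt_trans wr r1.
apply: le_trans (cauchy_coefficient_bound n r0 df) _.
have continuous_on_circle (F : R[i]^o -> R[i]^o) : analytic_on_disc F ->
    {in `[0, 2 * pi], continuous (fun t => F (r%:C * expi t))}.
  move=> aF t _.
  have cF := derivable_continuousC (aF _ (circ_disc t)).
  exact: (continuous_comp (@continuous_circle R r t) cF).
have cg0 t : 0 < cabs (g (r%:C * expi t)).
  apply: lt_le_trans (gpos _ (circ_disc t)) _.
  by apply: le_trans (cabs_ge_Re _); rewrite ler_norm.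
have ciw : {in `[0, 2 * pi], continuous (fun t =>
    (cabs (g (r%:C * expi t)) `^ (gamma / p))^-1 : R)}.
  move=> t tI; apply: cvgV; first by rewrite gt_eqF// powR_gt0.
  have cpow : {for cabs (g (r%:C * expi t)), continuous (fun x : R => x `^ (gamma / p))}.
    apply/differentiable_continuous/derivable1_diffP/derivable_powR.
    by rewrite in_itv/= andbT.
  exact: (continuous_comp (continuous_cabs_comp (continuous_on_circle g ag t tI)) cpow).
have iw := continuous_itv_integrable ciw.
(* The part of the pointwise bound that is constant on the circle of radius [r]. *)
pose D := K / (1 - r) `^ (2 / p) * bergman_norm phi p f.
have le_int : \int[lebesgue_measure]_(t in `[0, 2 * pi]) cabs (f (r%:C * expi t)) <=
    \int[lebesgue_measure]_(t in `[0, 2 * pi])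
      (D * (cabs (g (r%:C * expi t)) `^ (gamma / p))^-1).
  apply: le_Rintegral => //.
  - exact: (integrable_cabs (continuous_on_circle f (proj1 bf))).
  - exact: (integrableZl _ _ iw).
  - move=> t _; apply: le_trans (bergman_pointwise hp ag gpos gamma01 bf (circ_disc t)) _.
    rewrite cabs_circle ?(ltW r0)// -/K le_eqVlt; apply/orP; left; apply/eqP.
    by rewrite /D invfM; ring.
rewrite RintegralZl// in le_int.
have pr0 : 0 <= (pi * r ^+ n)^-1 by rewrite invr_ge0 mulr_ge0 ?pi_ge0 ?exprn_ge0 ?ltW.
apply: le_trans (ler_wpM2l pr0 le_int) _.
by rewrite le_eqVlt; apply/orP; left; apply/eqP; rewrite /D !invfM; ring.
Qed.
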